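(* Let $(q_n)$ be a sequence of positive integers with $q_n/n\to0$ and $q_n\asymp(\log n)^{\delta_2}$ for some $\delta_2>1$. Let $X_i=\theta_i+\epsilon_i$, $i=1,\dots,n$, with $\epsilon_i$ i.i.d. $N(0,1)$, and consider testing $H_{0i}:\theta_i=0$ against $H_{1i}:\theta_i\neq0$ simultaneously for $i=1,\dots,n$ with the empirical Bayes rule $\boldsymbol\psi=(\psi_1,\dots,\psi_n)$, $$\psi_i=\mathbf 1\Bigl\{\mathbb E(1-\kappa_i\mid X_i,\widehat\tau)>\tfrac12\Bigr\},\qquad \widehat\tau=\max\Bigl\{\frac1n,\ \frac1{c_2n}\sum_{j=1}^n\mathbf 1\bigl(|X_j|>\sqrt{c_1\log n}\bigr)\Bigr\},$$ where $c_1\ge2$ and $c_2\ge1$ are constants and $\mathbb E(1-\kappa_i\mid X_i,\widehat\tau)$ is the posterior shrinkage coefficient $\mathbb E(1-\kappa_i\mid X_i,\tau)$ (defined in the context) evaluated at $\tau=\widehat\tau$, computed under the one-group prior with exponent $a=\tfrac12$ and slowly varying function $L$. Assume that $L$ satisfies (A1) and (A2) of the context. Then for every fixed $b\in\mathbb R$, $$\sup_{\boldsymbol\theta\in\boldsymbol\Theta_b}R(\boldsymbol\theta,\boldsymbol\psi)=1-\Phi(b)+o(1)\qquad (n\to\infty),$$ where $R=\mathrm{FDR}+\mathrm{FNR}$ and the beta-min class $\boldsymbol\Theta_b$ are defined in the context. The same conclusion holds with $b$ replaced by any real sequence $b=b_n\to\infty$.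
   Context: One-group shrinkage prior: given $\tau>0$, independently over $i$, $\theta_i\mid\lambda_i,\tau\sim N(0,\lambda_i^2\tau^2)$ and $\lambda_i^2$ has probability density $\pi_1(t)=K\,t^{-a-1}L(t)$ on $(0,\infty)$, where $a>0$, $L:(0,\infty)\to(0,\infty)$ is measurable, continuous and slowly varying (at infinity), and $K>0$ is the normalizing constant; $a$ and $L$ do not depend on $n$. (Horseshoe-type priors are those with $a=\tfrac12$.) Shrinkage coefficient: $\kappa_i=1/(1+\lambda_i^2\tau^2)$, and $\mathbb E(1-\kappa_i\mid X_i,\tau)$ denotes the posterior mean of $1-\kappa_i$ given $X_i$ under this prior and $X_i\mid\theta_i\sim N(\theta_i,1)$; explicitly $$\mathbb E(1-\kappa_i\mid X_i=x,\tau)=\frac{\int_0^\infty \frac{t\tau^2}{1+t\tau^2}(1+t\tau^2)^{-1/2}e^{-x^2/(2(1+t\tau^2))}\,t^{-a-1}L(t)\,dt}{\int_0^\infty (1+t\tau^2)^{-1/2}e^{-x^2/(2(1+t\tau^2))}\,t^{-a-1}L(t)\,dt}.$$ Assumptions on $L$: (A1) there exist $c_0>0$ and $t_0>0$ such that $L(t)\ge c_0$ for all $t\ge t_0$; (A2) there exists $M\in(0,\infty)$ such that $\sup_{t\in(0,\infty)}L(t)\le M$. Beta-min class: for real $b$ (possibly depending on $n$), $\boldsymbol\Theta_b=\{\boldsymbol\theta\in\mathbb R^n:\ |S_{\boldsymbol\theta}|=q_n,\ |\theta_i|\ge\sqrt{2\log(n/q_n)}+b\ \text{for all } i\in S_{\boldsymbol\theta}\}$,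 where $S_{\boldsymbol\theta}=\{i:\theta_i\ne0\}$. Risk: $R(\boldsymbol\theta,\boldsymbol\psi)=\mathrm{FDR}(\boldsymbol\theta,\boldsymbol\psi)+\mathrm{FNR}(\boldsymbol\theta,\boldsymbol\psi)$, where $$\mathrm{FDR}(\boldsymbol\theta,\boldsymbol\psi)=\mathbb E_{\boldsymbol\theta}\left[\frac{\sum_{i:\theta_i=0}\psi_i}{\max\{\sum_{i=1}^n\psi_i,1\}}\right],\qquad \mathrm{FNR}(\boldsymbol\theta,\boldsymbol\psi)=\mathbb E_{\boldsymbol\theta}\left[\frac{\sum_{i:\theta_i\ne0}(1-\psi_i)}{\max\{|S_{\boldsymbol\theta}|,1\}}\right].$$ $\mathbb E_{\boldsymbol\theta}$ is expectation when the true mean vector is the fixed vector $\boldsymbol\theta$. $\Phi$ is the standard normal distribution function. For sequences, $a_n\asymp b_n$ means $0<c\le a_n/b_n\le c'<\infty$ for some constants $c,c'$ and all sufficiently large $n$. *)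

(* Defs.v *)
From HB Require Import structures.
From mathcomp Require Import all_boot all_order all_algebra.
From mathcomp Require Import all_classical all_reals all_analysis.

Set Implicit Arguments.
Unset Strict Implicit.
Unset Printing Implicit Defensive.

Import Order.TTheory GRing.Theory Num.Theory.
Import numFieldNormedType.Exports.

Local Open Scope classical_set_scope.
Local Open Scope ring_scope.

Definition asymp_equiv {R : realType} (u v : nat -> R) : Prop :=
  exists c c' : R, 0 < c /\ \forall n \near \oo, c <= u n / v n <= c'.

Definition std_normal_cdf {R : realType} (x : R) : R :=
  fine (normal_prob 0 1 `]-oo, x]).

Definition has_std_normal_law {d} {T : measurableType d} {R : realType}
    {P : probability T R} (X : {RV P >-> R}) : Prop :=
  forall A : set R, measurable A -> distribution P X A = normal_prob 0 1 A.

Definition mutually_independent {d} {T : measurableType d} {R : realType}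
    {P : probability T R} {n : nat} (X : 'I_n -> {RV P >-> R}) : Prop :=
  forall (J : {set 'I_n}) (A : 'I_n -> set R), (forall i, measurable (A i)) ->
    P (\bigcap_(i in [set` J]) (X i @^-1` A i)) =
    (\prod_(i in J) P (X i @^-1` A i))%E.

(* [L] is a function on (0, +oo); its values elsewhere are irrelevant. *)
Definition slowly_varying {R : realType} (L : R -> R) : Prop :=
  forall c : R, 0 < c -> L (c * t) / L t @[t --> +oo] --> (1 : R).

(* [lambda_i ^ 2] has density [K * t `^ (- a - 1) * L t] on (0, +oo). *)
Record one_group_prior {R : realType} (a : R) (L : R -> R) : Prop := {
  ogp_exponent : 0 < a ;
  ogp_pos : forall t : R, 0 < t -> 0 < L t ;
  ogp_measurable : measurable_fun (`]0, +oo[ : set R) L ;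
  ogp_continuous : {within (`]0, +oo[ : set R), continuous L} ;
  ogp_slowly_varying : slowly_varying L ;
  ogp_normalized : exists2 K : R, 0 < K &
    (\int[lebesgue_measure]_(t in `]0%R, +oo[)
       (K * (t `^ (- a - 1) * L t))%:E = 1)%E
}.

(* Likelihood of [X_i = x] given [lambda_i ^ 2 = t] (marginally over [theta_i],
   [X_i ~ N(0, 1 + t tau ^ 2)]) times the prior density of [lambda_i ^ 2]. The
   constants [K] and [(2 pi) ^ (- 1 / 2)] cancel in the posterior mean. *)
Definition posterior_weight {R : realType} (a : R) (L : R -> R) (x tau t : R)
    : R :=
  (1 + t * tau ^+ 2) `^ (- 2^-1) * expR (- x ^+ 2 / (2 * (1 + t * tau ^+ 2)))
  * (t `^ (- a - 1) * L t).

(* Posterior mean of [1 - kappa_i], [kappa_i = 1 / (1 + lambda_i ^ 2 tau ^ 2)],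
   given [X_i = x]. *)
Definition posterior_shrinkage {R : realType} (a : R) (L : R -> R) (x tau : R)
    : R :=
  (\int[lebesgue_measure]_(t in `]0, +oo[)
     ((t * tau ^+ 2) / (1 + t * tau ^+ 2) * posterior_weight a L x tau t))
  / (\int[lebesgue_measure]_(t in `]0, +oo[) posterior_weight a L x tau t).

Definition tau_hat {R : realType} (c1 c2 : R) (n : nat) (x : 'rV[R]_n) : R :=
  Num.max (1 / n%:R)
    (1 / (c2 * n%:R) * \sum_(j < n) (Num.sqrt (c1 * ln n%:R) < `|x 0 j|)%R%:R).

Definition eb_rule {R : realType} (a : R) (L : R -> R) (c1 c2 : R) (n : nat)
    (x : 'rV[R]_n) (i : 'I_n) : bool :=
  posterior_shrinkage a L (x 0 i) (tau_hat c1 c2 x) > 1 / 2.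

Definition supp {R : realType} {n : nat} (theta : 'rV[R]_n) : {set 'I_n} :=
  [set i | theta 0 i != 0]%SET.

Definition fdp {R : realType} {n : nat} (theta : 'rV[R]_n)
    (psi : 'I_n -> bool) : R :=
  (\sum_(i < n | theta 0 i == 0) (psi i)%:R)
  / Num.max (\sum_(i < n) (psi i)%:R) 1.

Definition fnp {R : realType} {n : nat} (theta : 'rV[R]_n)
    (psi : 'I_n -> bool) : R :=
  (\sum_(i < n | theta 0 i != 0) (1 - (psi i)%:R))
  / Num.max (#|supp theta|)%:R 1.

Section risk.
Context {d} {T : measurableType d} {R : realType} {P : probability T R}.
Context {n : nat} (eps : 'I_n -> {RV P >-> R}).

Definition observation (theta : 'rV[R]_n) (w : T) : 'rV[R]_n :=
  \row_i (theta 0 i + eps i w).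

Definition FDR (theta : 'rV[R]_n) (psi : 'rV[R]_n -> 'I_n -> bool) : \bar R :=
  'E_P[fun w => fdp theta (psi (observation theta w))]%E.

Definition FNR (theta : 'rV[R]_n) (psi : 'rV[R]_n -> 'I_n -> bool) : \bar R :=
  'E_P[fun w => fnp theta (psi (observation theta w))]%E.

Definition risk (theta : 'rV[R]_n) (psi : 'rV[R]_n -> 'I_n -> bool) : \bar R :=
  (FDR theta psi + FNR theta psi)%E.

End risk.

Definition beta_min_class {R : realType} (n q : nat) (b : R) : set 'rV[R]_n :=
  [set theta | #|supp theta| = q /\
     forall i, i \in supp theta ->
       `|theta 0 i| >= Num.sqrt (2 * ln (n%:R / q%:R)) + b].

Definition sup_risk {d} {T : measurableType d} {R : realType}
    {P : probability T R} {n : nat} (eps : 'I_n -> {RV P >-> R})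
    (psi : 'rV[R]_n -> 'I_n -> bool) (Theta : set 'rV[R]_n) : \bar R :=
  ereal_sup [set risk eps theta psi | theta in Theta].

(* Main.v *)
(** Everything follows from two deterministic facts about the posterior weight.
    For [0 < tau <= 1], a weight above 1/2 forces [tau * exp (x ^ 2 / 2)] to be
    bounded below: the mass of [lambda ^ 2] near 0 keeps the denominator above
    [c * exp (- x ^ 2 / 2)], while the numerator is [O(tau)]. Conversely, if
    [tau >= 1 / n] and [|x| > sqrt (2 log n) + delta], the weight exceeds 1/2 for
    large [n], because the mass at [t tau ^ 2] of order [x ^ 2] dominates the mass
    at [t tau ^ 2 <= 1].

    Since [c1 >= 2], the nulls counted by [tau_hat] number at most 1 on average,
    so [tau_hat <= 2 q / n] with probability [1 - O(1 / q)]. The random rejection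
    threshold thus lies between [sqrt (2 log (n / q)) - o(1)] and
    [sqrt (2 log n) + delta], and these bounds differ by [delta + o(1)] because [q]
    is polylogarithmic. Signals on the boundary of the class are therefore missed
    with probability [Phi(- b) + o(1)]. By Mills' inequality there are
    [O(q / sqrt (log n)) = o(q)] false rejections on average, against a fixed
    fraction of the [q] signals detected with high probability (Chebyshev), so the
    FDR vanishes. Sequences [b_n -> oo] follow since the classes decrease in [b].

    Measurability of the rule is never needed: the integral of an arbitrary
    function is monotone, and the two proportions are squeezed between finite
    combinations of indicators. *)

Require Import Defs.
From HB Require Import structures.
From mathcomp Require Import all_boot all_order all_algebra.
From mathcomp Require Import all_classical all_reals all_analysis.
From mathcomp Require Import measurable_realfun ring lra.

Set Implicit Arguments.
Unset Strict Implicit.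
Unset Printing Implicit Defensive.

Import Order.TTheory GRing.Theory Num.Theory.
Import numFieldNormedType.Exports.

Local Open Scope classical_set_scope.
Local Open Scope ring_scope.

(** * Expectations of non-measurable functions *)

Section mean_calculus.
Context {d} {T : measurableType d} {R : realType} (P : probability T R).
Implicit Types (f g : T -> R) (A : set T).

(** The integral of a nonnegative function is a supremum over the simple functions below it, and
    every simple function below [f] is also below [g]. *)
Lemma ge0_le_integral_nonmeasurable (f g : T -> \bar R) :
  (forall x, 0 <= f x)%E -> (forall x, f x <= g x)%E ->
  (\int[P]_x f x <= \int[P]_x g x)%E.
Proof.
move=> f0 fg.
rewrite !ge0_integralTE//; last by move=> x; exact: le_trans (fg x).
apply: ereal_sup_le => _ [h hf <-]; exists h => // x.
exact: le_trans (hf x) (fg x).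
Qed.

Lemma le_integral_nonmeasurable (f g : T -> \bar R) : (forall x, f x <= g x)%E ->
  (\int[P]_x f x <= \int[P]_x g x)%E.
Proof.
move=> fg; rewrite integralE [leRHS]integralE leeB//;
  apply: ge0_le_integral_nonmeasurable => // x.
- by apply: (@funepos_le _ _ setT f g) => [y _|]; [exact: fg|rewrite in_setT].
- by apply: (@funeneg_le _ _ setT f g) => [y _|]; [exact: fg|rewrite in_setT].
Qed.

(** Integrability and value travel together, so that the means of the explicit functions bracketing
    the two error proportions follow by linearity alone. *)
Definition has_mean g (e : R) : Prop :=
  P.-integrable setT (EFin \o g) /\ (\int[P]_w (g w)%:E = e%:E)%E.

Lemma has_mean_indic A : measurable A -> has_mean \1_A (fine (P A)).
Proof.
move=> mA; split; first exact: integrable_indic.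
by rewrite integral_indic// setIT fineK// fin_num_measure.
Qed.

Lemma has_mean_cst (c : R) : has_mean (cst c) c.
Proof.
split; first exact: finite_measure_integrable_cst.
by have := expectation_cst P c; rewrite unlock.
Qed.

Lemma has_meanD f g a b : has_mean f a -> has_mean g b ->
  has_mean (fun w => f w + g w) (a + b).
Proof.
move=> [fi fa] [gi gb]; split.
  by rewrite (_ : _ \o _ = (EFin \o f) \+ (EFin \o g))%E//; exact: integrableD.
by rewrite integralD_EFin// fa gb.
Qed.

Lemma has_meanZ c f a : has_mean f a -> has_mean (fun w => c * f w) (c * a).
Proof.
move=> [fi fa]; split.
  rewrite (_ : _ \o _ = (fun x => c%:E * (EFin \o f) x)%E)//.
  exact: integrableZl.
by under eq_integral do rewrite EFinM; rewrite integralZl// fa.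
Qed.

Lemma has_meanB f g a b : has_mean f a -> has_mean g b ->
  has_mean (fun w => f w - g w) (a - b).
Proof.
move=> fa gb; rewrite -mulN1r.
under eq_fun do rewrite -[- g _]mulN1r.
by apply: has_meanD => //; exact: has_meanZ.
Qed.

Lemma has_mean_sum (I : Type) (r : seq I) (Q : pred I) (f : I -> T -> R)
    (a : I -> R) : (forall i, Q i -> has_mean (f i) (a i)) ->
  has_mean (fun w => \sum_(i <- r | Q i) f i w) (\sum_(i <- r | Q i) a i).
Proof.
move=> fa; elim: r => [|i r IH].
  rewrite big_nil; under eq_fun do rewrite big_nil.
  exact: has_mean_cst.
rewrite big_cons; under eq_fun do rewrite big_cons.
by case: ifPn => // Qi; apply: has_meanD => //; exact: fa.
Qed.

(** All regularity is carried by the bracketing function [g]; [f] is arbitrary, as the false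
    discovery proportion of the rule will be. *)
Lemma expectation_le_mean f g e : has_mean g e -> (forall w, f w <= g w) ->
  ('E_P[f] <= e%:E)%E.
Proof.
move=> [_ <-] fg; rewrite unlock.
by apply: le_integral_nonmeasurable => w; rewrite lee_fin.
Qed.

Lemma mean_le_expectation f g e : has_mean g e -> (forall w, g w <= f w) ->
  (e%:E <= 'E_P[f])%E.
Proof.
move=> [_ <-] fg; rewrite unlock.
by apply: le_integral_nonmeasurable => w; rewrite lee_fin.
Qed.

End mean_calculus.

(** * Standard normal tails *)

Section gaussian.
Context {R : realType}.
Local Notation Phi := (@std_normal_cdf R).
Local Notation mu := (@lebesgue_measure R).
Local Notation N := (@normal_prob R 0 1).
Implicit Types x y b t : R.

Lemma std_normal_pdfE x : normal_pdf 0 1 x = normal_peak 1 * expR (- x ^+ 2 / 2).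
Proof. by rewrite normal_pdfE ?oner_neq0// /normal_fun subr0 expr1n. Qed.

Lemma std_normal_peak_le1 : normal_peak (1 : R) <= 1.
Proof.
have p2 := pi_ge2 R; rewrite /normal_peak expr1n mul1r.
have p0 : 1 <= pi *+ 2 :> R by rewrite mulr2n; move: p2; set p := pi => p2; lra.
rewrite invf_le1 ?sqrtr_gt0 ?(lt_le_trans ltr01 p0)//.
by rewrite -[leLHS]sqrtr1 ler_wsqrtr.
Qed.

Lemma normal_prob_le1 (A : set R) : measurable A -> (N A <= 1)%E.
Proof. by move=> mA; exact: probability_le1. Qed.

Lemma fine_normal_probK (A : set R) : measurable A -> (fine (N A))%:E = N A.
Proof. by move=> mA; rewrite fineK// fin_num_measure. Qed.

Lemma normal_prob_set1 x : N [set x] = 0%E.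
Proof.
have /null_content_dominatesP h := normal_prob_dominates (0 : R) 1.
by apply: h => //; exact: lebesgue_measure_set1.
Qed.

Lemma std_normal_cdf_ge0 x : 0 <= Phi x.
Proof. by rewrite fine_ge0. Qed.

Lemma std_normal_cdfE x : (Phi x)%:E = N `]-oo, x].
Proof. exact: fine_normal_probK. Qed.

Lemma std_normal_cdf_le1 x : Phi x <= 1.
Proof. by rewrite -lee_fin std_normal_cdfE normal_prob_le1. Qed.

Lemma le_std_normal_cdf x y : x <= y -> Phi x <= Phi y.
Proof.
move=> xy; rewrite -lee_fin !std_normal_cdfE le_measure ?inE//.
exact: subset_itvl.
Qed.

(** Reflection [y -> - y] preserves the centred density. *)
Lemma normal_prob_cy x : N `[x, +oo[ = (Phi (- x))%:E.
Proof.
rewrite std_normal_cdfE /normal_prob ge0_integration_by_substitutionNy.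
- by apply: eq_integral => y _ /=; rewrite !std_normal_pdfE sqrrN.
- by apply: continuous_subspaceT; apply: continuous_normal_pdf; rewrite oner_neq0.
- by move=> y _; exact: normal_pdf_ge0.
Qed.

Lemma normal_prob_oy x : N `]x, +oo[ = (Phi (- x))%:E.
Proof.
rewrite -normal_prob_cy -(@setU1itv _ _ +oo%O x false) ?bnd_simp// measureU//; last first.
  by rewrite -subset0 => y [/= ->]; rewrite in_itv/= ltxx.
by rewrite [X in (X + _)%E]normal_prob_set1 add0e.
Qed.

Lemma normal_prob_Nyo x : N `]-oo, x[ = (Phi x)%:E.
Proof.
rewrite std_normal_cdfE -(@setUitv1 _ _ -oo%O x true) ?bnd_simp// measureU//; last first.
  by rewrite -subset0 => y /= [+ yx]; rewrite yx in_itv/= ltxx.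
by rewrite [X in (_ + X)%E]normal_prob_set1 adde0.
Qed.

Lemma std_normal_cdfN x : Phi (- x) = 1 - Phi x.
Proof.
apply: EFin_inj; rewrite -normal_prob_oy EFinB std_normal_cdfE.
by rewrite -setCitvl probability_setC.
Qed.

(** The density is at most its peak, which is at most 1. This turns small shifts of a threshold into
    small changes of a detection probability. *)
Lemma std_normal_cdf_lipschitz x y : x <= y -> Phi y - Phi x <= y - x.
Proof.
move=> xy; rewrite lerBlDl -lee_fin EFinD !std_normal_cdfE.
rewrite (@itv_bndbnd_setU _ _ -oo%O (BRight x)) ?bnd_simp//.
rewrite measureU//; last first.
  by rewrite -subset0 => z []/=; rewrite !in_itv/= => zx /andP[]; rewrite ltNge zx.
rewrite leeD2l//; apply: (@le_trans _ _ (\int[mu]_(z in `]x, y]) 1%:E)%E).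
  apply: ge0_le_integral => //.
  - by move=> z _; rewrite lee_fin normal_pdf_ge0.
  - apply/measurable_EFinP; apply: measurable_funTS; exact: measurable_normal_pdf.
  - by move=> z _; rewrite lee_fin (le_trans (normal_pdf_ub _ _ (oner_neq0 _)))//
      std_normal_peak_le1.
rewrite integral_cst//= mul1e lebesgue_measure_itv/= lte_fin.
by case: ifPn => [_|_]; rewrite -?EFinB ?lee_fin// subr_ge0.
Qed.

(** The unit interval [[x - 1, x]] already has positive mass: on it [|z| <= |x| + 1], so the density
    is at least the constant [k]. *)
Lemma std_normal_cdf_gt0 x : 0 < Phi x.
Proof.
set k := normal_peak (1 : R) * expR (- (`|x| + 1) ^+ 2 / 2).
have k0 : 0 < k by rewrite mulr_gt0 ?expR_gt0 ?normal_peak_gt0 ?oner_neq0.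
apply: (lt_le_trans k0); rewrite -lee_fin std_normal_cdfE.
apply: (@le_trans _ _ (N `[x - 1, x])); last first.
  by rewrite le_measure ?inE//; exact: subset_itvr.
apply: (@le_trans _ _ (\int[mu]_(z in `[(x - 1)%R, x]) k%:E)%E).
  rewrite integral_cst//= lebesgue_measure_itv/= lte_fin ltrBlDr ltrDl ltr01.
  by rewrite -EFinB opprB addrC subrK mule1.
apply: ge0_le_integral => //.
- by move=> z _; rewrite lee_fin ltW.
- apply/measurable_EFinP; apply: measurable_funTS; exact: measurable_normal_pdf.
- move=> z; rewrite /= in_itv/= => /andP[xz zx].
  rewrite lee_fin std_normal_pdfE ler_pM2l ?normal_peak_gt0 ?oner_neq0//.
  rewrite ler_expR !mulNr lerN2 ler_pM2r ?invr_gt0// -[leLHS]real_normK ?num_real//.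
  rewrite ler_pXn2r ?nnegrE ?addr_ge0//.
  have := ler_norm x; have := ler_norm (- x); rewrite normrN.
  by case: (ler0P z); lra.
Qed.

(** Mills' inequality: on [[t, +oo[] the density is at most [z / t * expR (- z ^+ 2 / 2)], which has
    an elementary antiderivative. *)
Lemma std_normal_tail t : 0 < t -> Phi (- t) <= expR (- t ^+ 2 / 2) / t.
Proof.
move=> t0; rewrite -lee_fin -normal_prob_cy.
pose f z : R := z * expR (- z ^+ 2 / 2).
have dF (z : R) : is_derive z 1 (fun z => - expR (- z ^+ 2 / 2)) (f z).
  apply: is_derive_eq; rewrite /f /GRing.scale/=; lra.
have cf : continuous f.
  move=> z; apply: cvgM; first exact: cvg_id.
  apply: (cvg_comp _ expR); last exact: continuous_expR.
  apply: cvgM; last exact: cvg_cst.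
  by apply: (@cvgN _ R^o); exact: exprn_continuous.
have If : (\int[mu]_(z in `[t, +oo[) (f z)%:E = (expR (- t ^+ 2 / 2))%:E)%E.
  rewrite (@ge0_continuous_FTC2y _ f (fun z => - expR (- z ^+ 2 / 2)) t 0).
  - by rewrite sub0e -EFinN opprK.
  - by move=> z tz; rewrite mulr_ge0 ?expR_ge0// (le_trans _ tz)// ltW.
  - exact: continuous_subspaceT.
  - rewrite -[X in _ --> X]oppr0; apply: cvgN.
    under eq_fun do rewrite mulNr.
    apply: (cvg_comp (fun z : R => z ^+ 2 / 2) (fun z => expR (- z))).
      by apply: gt0_cvgMly => //; exact: cvgr_expr2.
    exact: cvgr_expR.
  - by move=> z _; case: (dF z).
  - apply: cvg_at_right_filter.
    suff : {for t, continuous (fun z : R => - expR (- z ^+ 2 / 2))} by [].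
    by apply: differentiable_continuous; apply/derivable1_diffP; case: (dF t).
  - by move=> z _; rewrite derive1E; case: (dF z).
apply: (@le_trans _ _ (\int[mu]_(z in `[t, +oo[) (t^-1%:E * (f z)%:E))%E).
  apply: ge0_le_integral => //.
  - by move=> z _; rewrite lee_fin normal_pdf_ge0.
  - apply/measurable_EFinP; apply: measurable_funTS; exact: measurable_normal_pdf.
  - apply/measurable_EFinP; apply: measurable_funTS; apply: measurable_funM => //.
    exact: continuous_measurable_fun.
  - move=> z; rewrite /= in_itv/= andbT => tz.
    rewrite -EFinM lee_fin std_normal_pdfE /f mulrA ler_pM2r ?expR_gt0//.
    by rewrite (le_trans std_normal_peak_le1)// mulrC ler_pdivlMr// mul1r.
rewrite ge0_integralZl//.
- by rewrite If -EFinM mulrC.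
- apply/measurable_EFinP; apply: measurable_funTS; exact: continuous_measurable_fun.
- move=> z; rewrite /= in_itv/= andbT => tz.
  by rewrite lee_fin mulr_ge0 ?expR_ge0// (le_trans _ tz)// ltW.
- by rewrite lee_fin invr_ge0 ltW.
Qed.

End gaussian.

(** * Posterior shrinkage weights *)

Lemma continuous_sqrt_comp {R : realType} (f : R -> R) (x : R) :
  {for x, continuous f} -> {for x, continuous (fun t => Num.sqrt (f t))}.
Proof.
by move=> cf; apply: (cvg_comp f (@Num.sqrt R)); [exact: cf|exact: sqrt_continuous].
Qed.

Lemma continuous_affine {R : realType} (a b : R) : continuous (fun t : R => a + t * b).
Proof.
by move=> t; apply: cvgD; [exact: cvg_cst|apply: cvgM; [exact: cvg_id|exact: cvg_cst]].
Qed.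

(* With [s = t * tau ^ 2], the antiderivative is [2 * tau * sqrt (s / (1 + s))]. *)
Lemma shrinkage_tail_integral {R : realType} (tau : R) : 0 < tau ->
  let g t := tau ^+ 2 / (Num.sqrt (1 + t * tau ^+ 2) ^+ 3 * Num.sqrt t) in
  (lebesgue_measure.-integrable (`[1, +oo[%classic : set R) (EFin \o g) /\
   \int[lebesgue_measure]_(t in `[1, +oo[) g t <= 2 * tau).
Proof.
move=> tau0 g.
have tt : 0 < tau ^+ 2 by rewrite exprn_gt0.
have op (t : R) : 0 < t -> 0 < 1 + t * tau ^+ 2 by move=> t0; rewrite addr_gt0// mulr_gt0.
have g0 t : 1 <= t -> 0 <= g t.
  move=> _; rewrite divr_ge0 ?(ltW tt)// mulr_ge0 ?exprn_ge0 ?sqrtr_ge0//.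
pose G t := 2 * tau ^+ 2 * (Num.sqrt t * (Num.sqrt (1 + t * tau ^+ 2))^-1).
have cg (t : R) : 0 < t -> {for t, continuous g}.
  move=> t0; apply: cvgM; first exact: cvg_cst.
  apply: cvgV.
    by rewrite mulf_neq0 ?expf_neq0 ?gt_eqF ?sqrtr_gt0 ?op.
  apply: cvgM; last exact: sqrt_continuous.
  have h : {for t, continuous (fun t : R => Num.sqrt (1 + t * tau ^+ 2))}.
    by apply: continuous_sqrt_comp; exact: continuous_affine.
  by apply: (cvg_comp _ (fun y : R => y ^+ 3) h); exact: exprn_continuous.
have dG (t : R) : 0 < t -> is_derive t 1 G (g t).
  move=> t0; have v0 := op _ t0.
  have d1 : is_derive t 1 (fun t : R => 1 + t * tau ^+ 2) (tau ^+ 2).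
    by apply: is_derive_eq; rewrite /GRing.scale/=; ring.
  have d2 := @is_derive1_comp _ (@Num.sqrt R) (fun t : R => 1 + t * tau ^+ 2) _ _ _
      (is_derive1_sqrt v0) d1.
  have nz : (@Num.sqrt R \o (fun t : R => 1 + t * tau ^+ 2)) t != 0.
    by rewrite /= gt_eqF ?sqrtr_gt0.
  have d3 := is_deriveV nz d2.
  have d4 := is_deriveZ (2 * tau ^+ 2) (is_deriveM (is_derive1_sqrt t0) d3).
  apply: is_derive_eq d4 _.
  rewrite /g /GRing.scale/=.
  set r := Num.sqrt t; set v := Num.sqrt (1 + t * tau ^+ 2).
  have r0 : r != 0 by rewrite gt_eqF ?sqrtr_gt0.
  have vn0 : v != 0 by rewrite gt_eqF ?sqrtr_gt0.
  have vv : v ^+ 2 - r ^+ 2 * tau ^+ 2 = 1 by rewrite !sqr_sqrtr ?ltW// addrK.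
  (* Replacing 1 by [v ^+ 2 - r ^+ 2 * tau ^+ 2] in the numerator makes the claim a rational
     identity in [r], [v] and [tau]. *)
  rewrite -[X in _ = X / _]mulr1 -[X in _ = _ * X / _]vv; field.
  by rewrite r0 vn0.
have intg : (\int[lebesgue_measure]_(t in `[1%R, +oo[) (g t)%:E = (2 * tau)%:E - (G 1)%:E)%E.
  rewrite (@ge0_continuous_FTC2y _ g G 1 (2 * tau)).
  - by [].
  - exact: g0.
  - by apply: continuous_in_subspaceT => t; rewrite inE/= in_itv/= andbT => t1; apply: cg;
      exact: lt_le_trans t1.
  (* [H] is [G] with [s / (1 + s)] written as [1 - 1 / (1 + s)], a form in which the limit [2 * tau]
     is visible. *)
  - pose H t : R := 2 * tau * Num.sqrt (1 - (1 + t * tau ^+ 2)^-1).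
    have Hl : H t @[t --> +oo] --> 2 * tau.
      have Hu : (1 - (1 + t * tau ^+ 2)^-1) @[t --> +oo] --> (1 : R).
        rewrite -[X in _ --> X]subr0; apply: cvgB; first exact: cvg_cst.
        apply/gtr0_cvgV0.
          by near=> t; apply: op; near: t; exact: nbhs_pinfty_gt.
        apply: (cvg_comp (fun t => t * tau ^+ 2) (fun y => 1 + y)); last exact: cvg_addrl.
        by apply: gt0_cvgMly => //; exact: cvg_id.
      rewrite -[X in _ --> X]mulr1; apply: cvgM; first exact: cvg_cst.
      rewrite -[X in _ --> X]sqrtr1; apply: (cvg_comp _ (@Num.sqrt R) Hu);
          exact: sqrt_continuous.
    apply: cvg_trans Hl; apply: near_eq_cvg; near=> t.
    have t0 : 0 < t by near: t; exact: nbhs_pinfty_gt.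
    have v0 := op _ t0.
    have e : 1 - (1 + t * tau ^+ 2)^-1 = t * tau ^+ 2 * (1 + t * tau ^+ 2)^-1.
      by field; rewrite gt_eqF.
    rewrite /H /G e.
    rewrite sqrtrM ?(mulr_ge0 (ltW t0) (ltW tt))//.
    rewrite sqrtrM ?(ltW t0)//.
    rewrite sqrtr_sqr gtr0_norm// sqrtrV ?(ltW v0)//; ring.
  - by move=> t t1; case: (dG t (lt_trans ltr01 t1)).
  - apply: cvg_at_right_filter.
    suff : {for 1, continuous G} by [].
    by apply: differentiable_continuous; apply/derivable1_diffP; case: (dG 1 ltr01).
  - move=> t; rewrite in_itv/= andbT => t1.
    by rewrite derive1E; case: (dG t (lt_trans ltr01 t1)).
split.
  apply/integrableP; split.
    apply/measurable_EFinP;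
        apply: (@measurable_funS _ _ _ _ (`]0, +oo[%classic : set R)) => //.
      by apply: subset_itvr; rewrite bnd_simp.
    apply: open_continuous_measurable_fun => // t.
    by rewrite inE/= in_itv/= andbT; exact: cg.
  rewrite [X in (X < _)%E](_ : _ = (2 * tau)%:E - (G 1)%:E)%E ?ltry// -intg.
  by apply: eq_integral => t; rewrite inE/= in_itv/= andbT => t1; rewrite ger0_norm// g0.
rewrite /Rintegral intg/= lerBlDr lerDl.
by rewrite mulr_ge0 ?(mulr_ge0 _ (ltW tt))// mulr_ge0 ?invr_ge0 ?sqrtr_ge0.
Unshelve. all: by end_near. Qed.
Section posterior.
Context {R : realType}.
Local Notation mu := (@lebesgue_measure R).
Local Notation D := (`]0, +oo[%classic : set R).
Variable L : R -> R.
Hypothesis prior : one_group_prior (1 / 2) L.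
Variables c0 t0 M : R.
Hypothesis c0_gt0 : 0 < c0.
Hypothesis t0_gt0 : 0 < t0.
Hypothesis L_ge : forall t, t0 <= t -> c0 <= L t.
Hypothesis M_gt0 : 0 < M.
Hypothesis L_le : forall t, 0 < t -> L t <= M.
Implicit Types x tau t : R.

(** Density of [lambda_i ^ 2] up to the normalizing constant, at the horseshoe exponent 1/2. *)
Let dens t : R := t `^ (- (1 / 2) - 1) * L t.

Lemma onegroup_dens_ge0 t : 0 < t -> 0 <= dens t.
Proof. by move=> tp; rewrite mulr_ge0 ?powR_ge0// ltW// (ogp_pos prior). Qed.

Lemma measurable_onegroup_dens : measurable_fun D dens.
Proof.
apply: measurable_funM; last exact: ogp_measurable prior.
by apply: measurable_funTS; exact: measurable_powR.
Qed.

Lemma onegroup_dens_integral : mu.-integrable D (EFin \o dens) /\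
  0 < \int[mu]_(t in D) dens t.
Proof.
have [K K0 intK] := ogp_normalized prior.
have iK : mu.-integrable D (EFin \o (fun t => K * dens t)).
  apply/integrableP; split.
    by apply/measurable_EFinP/measurable_funM => //; exact: measurable_onegroup_dens.
  rewrite [X in (X < _)%E](_ : _ = 1%E) ?ltry// -intK.
  apply: eq_integral => t; rewrite inE/= in_itv/= andbT => tp.
  by rewrite ger0_norm// mulr_ge0 ?(ltW K0)// onegroup_dens_ge0.
have id : mu.-integrable D (EFin \o dens).
  rewrite (_ : _ \o _ = (fun t => K^-1%:E * (EFin \o (fun t => (K * dens t)%R)) t)%E).
    exact: integrableZl.
  by apply/funext => t/=; rewrite -EFinM mulKf ?gt_eqF.
split => //.
have : \int[mu]_(t in D) (K * dens t) = 1 by rewrite /Rintegral intK.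
rewrite RintegralZl// => KJ.
by rewrite -(pmulr_rgt0 _ K0) KJ.
Qed.

Lemma one_plus_gt0 t tau : 0 < t -> 0 < 1 + t * tau ^+ 2.
Proof. by move=> tp; rewrite ltr_pwDl// mulr_ge0 ?sqr_ge0// ltW. Qed.

Lemma measurable_one_plus_inv tau : measurable_fun D (fun t => (1 + t * tau ^+ 2)^-1).
Proof.
apply: (@eq_measurable_fun _ _ _ _ _ (fun t => (1 + t * tau ^+ 2) `^ (-1))).
  move=> t; rewrite inE/= in_itv/= andbT => tp.
  by rewrite powR_inv1// ltW// one_plus_gt0.
apply: (@measurableT_comp _ _ _ _ _ _ (fun y : R => y `^ (-1))); first exact: measurable_powR.
by apply: measurable_funD => //; exact: measurable_funM.
Qed.

Definition likelihood x tau t : R :=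
  (1 + t * tau ^+ 2) `^ (- 2^-1) * expR (- x ^+ 2 / (2 * (1 + t * tau ^+ 2))).

Lemma posterior_weightE x tau t :
  posterior_weight (1 / 2) L x tau t = likelihood x tau t * dens t.
Proof. by []. Qed.

Lemma likelihood_ge0 x tau t : 0 <= likelihood x tau t.
Proof. by rewrite mulr_ge0 ?powR_ge0 ?expR_ge0. Qed.

Lemma powR_one_plus_le1 tau t : 0 < t -> (1 + t * tau ^+ 2) `^ (- 2^-1) <= 1.
Proof.
move=> tp; rewrite powRN powR12_sqrt ?(ltW (one_plus_gt0 _ tp))//.
rewrite invf_le1 ?sqrtr_gt0 ?one_plus_gt0// -[leLHS]sqrtr1 ler_wsqrtr//.
by rewrite lerDl mulr_ge0 ?sqr_ge0// ltW.
Qed.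

Lemma likelihood_le x tau t : 0 < t ->
  likelihood x tau t <= expR (- x ^+ 2 / (2 * (1 + t * tau ^+ 2))).
Proof. by move=> tp; rewrite ler_piMl ?expR_ge0// powR_one_plus_le1. Qed.

Lemma likelihood_le1 x tau t : 0 < t -> likelihood x tau t <= 1.
Proof.
move=> tp; apply: le_trans (likelihood_le _ _ tp) _.
rewrite -[leRHS]expR0 ler_expR mulNr oppr_le0 divr_ge0 ?sqr_ge0//.
by rewrite mulr_ge0// ltW// one_plus_gt0.
Qed.

Lemma measurable_likelihood x tau : measurable_fun D (likelihood x tau).
Proof.
apply: measurable_funM.
  apply: (@measurableT_comp _ _ _ _ _ _ (fun y : R => y `^ (- 2^-1)));
      first exact: measurable_powR.
  by apply: measurable_funD => //; exact: measurable_funM.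
apply: measurableT_comp => //; apply: (@eq_measurable_fun _ _ _ _ _
  (fun t => - x ^+ 2 / 2 * (1 + t * tau ^+ 2)^-1)).
  by move=> t _ /=; rewrite invfM; ring.
by apply: measurable_funM => //; exact: measurable_one_plus_inv.
Qed.

(** The prior has finite mass, so any measurable factor bounded by 1 keeps it integrable; likelihood
    and shrinkage factors are of this kind. *)
Lemma integrable_weighted (h : R -> R) : measurable_fun D h ->
  (forall t, 0 < t -> `|h t| <= 1) ->
  mu.-integrable D (EFin \o (fun t => h t * dens t)).
Proof.
move=> mh h1; 
have := @le_integrable _ _ R mu D (measurable_itv _)
  (EFin \o (fun t => h t * dens t)) (EFin \o dens).
apply; last exact: onegroup_dens_integral.1.
- by apply/measurable_EFinP/measurable_funM => //; exact: measurable_onegroup_dens.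
- move=> t; rewrite /= in_itv/= andbT => tp; rewrite lee_fin normrM.
  by rewrite ler_piMl// h1.
Qed.

Lemma integrable_posterior_weight x tau :
  mu.-integrable D (EFin \o posterior_weight (1 / 2) L x tau).
Proof.
apply: integrable_weighted; first exact: measurable_likelihood.
by move=> t tp; rewrite ger0_norm ?likelihood_ge0// likelihood_le1.
Qed.

Lemma integrable_shrinkage_weight x tau :
  mu.-integrable D (EFin \o (fun t => t * tau ^+ 2 / (1 + t * tau ^+ 2) *
                                      posterior_weight (1 / 2) L x tau t)).
Proof.
rewrite (_ : (fun t => _) = (fun t => t * tau ^+ 2 / (1 + t * tau ^+ 2) *
    likelihood x tau t * dens t)); last first.
  by apply/funext => t; rewrite posterior_weightE mulrA.
apply: integrable_weighted.
  apply: measurable_funM; last exact: measurable_likelihood.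
  by apply: measurable_funM; [exact: measurable_funM|exact: measurable_one_plus_inv].
move=> t tp; rewrite normrM (ger0_norm (likelihood_ge0 _ _ _)) mulr_ile1 ?likelihood_ge0//.
  rewrite ger0_norm ?divr_ge0 ?(ltW (one_plus_gt0 _ tp))// ?(mulr_ge0 (ltW tp) (sqr_ge0 _))//.
  by rewrite ler_pdivrMr ?one_plus_gt0// mul1r lerDr.
exact: likelihood_le1.
Qed.

Lemma Rintegral_cst_indic (A : set R) (c l : R) : measurable A -> A `<=` D ->
  mu A = l%:E ->
  mu.-integrable D (EFin \o (fun t => c * \1_A t)) /\
  \int[mu]_(t in D) (c * \1_A t) = c * l.
Proof.
move=> mA AD muA.
have iA : mu.-integrable D (EFin \o \1_A).
  apply/integrableP; split; first exact/measurable_EFinP/measurable_indic.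
  rewrite [X in (X < _)%E](_ : _ = l%:E) ?ltry//.
  rewrite -muA -[in RHS](setIidl AD) -integral_indic//.
  by apply: eq_integral => t _; rewrite /= ger0_norm.
split.
  rewrite (_ : _ \o _ = (fun t => c%:E * (EFin \o \1_A) t)%E) //.
  exact: integrableZl.
by rewrite RintegralZl// /Rintegral integral_indic// setIidl// [X in fine X]muA.
Qed.

(** Comparing [t] with a square replaces the power -3/2 by the integer power [b ^+ 3]; (A1) bounds
    [L] from below. *)
Lemma onegroup_dens_ge t b : t0 <= t -> 0 < b -> t <= b ^+ 2 -> c0 / b ^+ 3 <= dens t.
Proof.
move=> t0t b0 tb; have tp := lt_le_trans t0_gt0 t0t.
rewrite /dens mulrC ler_pM ?invr_ge0 ?exprn_ge0 ?(ltW c0_gt0) ?(ltW b0) ?L_ge//.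
rewrite (_ : - (1 / 2) - 1 = - (2^-1 + 1)); last by field.
rewrite powRN lef_pV2 ?posrE ?powR_gt0 ?exprn_gt0//.
rewrite powRD ?gt_eqF ?implybT// powRr1 ?(ltW tp)// powR12_sqrt ?(ltW tp)//.
rewrite exprSr mulrC ler_pM ?sqrtr_ge0 ?(ltW tp)//.
by rewrite -[leRHS]ger0_norm ?(ltW b0)// -sqrtr_sqr ler_wsqrtr.
Qed.

Lemma onegroup_dens_le t b : 0 < b -> b ^+ 2 <= t -> dens t <= M / b ^+ 3.
Proof.
move=> b0 bt; have tp : 0 < t by rewrite (lt_le_trans _ bt)// exprn_gt0.
rewrite /dens mulrC ler_pM ?powR_ge0 ?L_le ?(ltW (ogp_pos prior tp))//.
rewrite (_ : - (1 / 2) - 1 = - (2^-1 + 1)); last by field.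
rewrite powRN lef_pV2 ?posrE ?powR_gt0 ?exprn_gt0//.
rewrite powRD ?gt_eqF ?implybT// powRr1 ?(ltW tp)// powR12_sqrt ?(ltW tp)//.
rewrite exprSr mulrC ler_pM ?exprn_ge0 ?(ltW b0)//.
by rewrite -[leLHS]ger0_norm ?(ltW b0)// -sqrtr_sqr ler_wsqrtr.
Qed.

(** For [tau <= 1] the likelihood is at least [(1 + t) ^ (- 1 / 2) * expR (- x ^+ 2 / 2)] pointwise,
    so [c] is the prior integral of the first factor. *)
Lemma posterior_weight_integral_ge : exists2 c : R, 0 < c & forall x tau,
  0 <= tau -> tau <= 1 ->
  c * expR (- x ^+ 2 / 2) <= \int[mu]_(t in D) posterior_weight (1 / 2) L x tau t.
Proof.
pose h t : R := (1 + t) `^ (- 2^-1).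
have mh : measurable_fun D h.
  apply: (@measurableT_comp _ _ _ _ _ _ (fun y : R => y `^ (- 2^-1)));
      first exact: measurable_powR.
  exact: measurable_funD.
have h1 t : 0 < t -> `|h t| <= 1.
  move=> tp; rewrite ger0_norm ?powR_ge0//.
  by have := powR_one_plus_le1 1 tp; rewrite expr1n mulr1.
have ih : mu.-integrable D (EFin \o (fun t => h t * dens t)) by exact: integrable_weighted.
exists (\int[mu]_(t in D) (h t * dens t)).
  (* Adding 1 gives the interval [A] unit length and makes [b >= 1], so that [t <= b] implies
     [t <= b ^+ 2]. *)
  pose b := t0 + 1; have b0 : 0 < b by rewrite addr_gt0.
  pose A : set R := `[t0, b]%classic.
  pose k := (1 + b) `^ (- 2^-1) * (c0 / b ^+ 3).
  have k0 : 0 < k by rewrite mulr_gt0 ?powR_gt0 ?addr_gt0// divr_gt0 ?exprn_gt0.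
  have AD : A `<=` D.
    by move=> t; rewrite /A/= !in_itv/= andbT => /andP[+ _]; exact: lt_le_trans.
  have muA : mu A = 1%:E.
    rewrite /A lebesgue_measure_itv/= lte_fin /b ltrDl ltr01 -EFinB.
    by rewrite addrAC subrr add0r.
  have [iA IA] := @Rintegral_cst_indic A k 1 (measurable_itv _) AD muA.
  apply: (lt_le_trans k0); rewrite -[leLHS]mulr1 -IA; apply: le_Rintegral => // t.
  rewrite /= in_itv/= andbT => tp; rewrite indicE.
  case: (boolP (t \in A)) => [|_]; last by rewrite mulr0 mulr_ge0 ?powR_ge0 ?onegroup_dens_ge0.
  rewrite inE /A/= in_itv/= mulr1 => /andP[t0t tb].
  apply: ler_pM; rewrite ?powR_ge0//.
  - by rewrite divr_ge0 ?exprn_ge0 ?(ltW b0) ?(ltW c0_gt0).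
  - rewrite /h !powRN lef_pV2 ?posrE ?powR_gt0 ?addr_gt0//.
    by rewrite ge0_ler_powR ?nnegrE ?lerD2l// addr_ge0// ltW.
  - apply: onegroup_dens_ge => //; apply: (le_trans tb).
    by rewrite expr2 ler_peMr ?(ltW b0)// lerDr ltW.
move=> x tau tau0 tau1.
rewrite -RintegralZr//; apply: le_Rintegral => //.
- rewrite (_ : _ \o _ = (fun t => (EFin \o (fun t => (h t * dens t)%R)) t * (expR (- x ^+ 2
    / 2))%:E)%E)//.
  exact: integrableZr.
- exact: integrable_posterior_weight.
move=> t; rewrite /= in_itv/= andbT => tp.
rewrite posterior_weightE mulrAC ler_wpM2r ?onegroup_dens_ge0//.
have t2 : t * tau ^+ 2 <= t by rewrite ler_piMr ?(ltW tp)// expr_le1.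
apply: ler_pM; rewrite ?powR_ge0 ?expR_ge0//.
  rewrite /h !powRN lef_pV2 ?posrE ?powR_gt0 ?one_plus_gt0//; last by rewrite addr_gt0.
  by rewrite ge0_ler_powR ?nnegrE ?(ltW (one_plus_gt0 _ _))// ?lerD2l// addr_ge0// ltW.
rewrite ler_expR !mulNr lerN2 ler_wpM2l ?sqr_ge0//.
rewrite lef_pV2 ?posrE ?mulr_gt0 ?one_plus_gt0//.
by rewrite ler_pMr// lerDl mulr_ge0 ?sqr_ge0// ltW.
Qed.

(** Split at [t = 1]. Below it the shrinkage factor is at most [tau ^+ 2 <= tau], against a prior of
    mass [J]. Above it (A2) gives [dens t <= M * t ^ (- 3 / 2)], and the integrand is dominated by
    [M] times the function of [shrinkage_tail_integral]. *)
Lemma shrinkage_integral_le : exists2 C : R, 0 < C & forall x tau,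
  0 < tau -> tau <= 1 ->
  \int[mu]_(t in D) (t * tau ^+ 2 / (1 + t * tau ^+ 2) *
                     posterior_weight (1 / 2) L x tau t) <= C * tau.
Proof.
pose J := \int[mu]_(t in D) dens t.
have [iJ J0] := onegroup_dens_integral.
exists (J + 2 * M); first by rewrite addr_gt0// mulr_gt0.
move=> x tau tau0 tau1.
have [ig Ig] := shrinkage_tail_integral tau0.
pose g t := tau ^+ 2 / (Num.sqrt (1 + t * tau ^+ 2) ^+ 3 * Num.sqrt t).
rewrite -/g in ig Ig.
have D1 : D `&` `[1, +oo[%classic = `[1, +oo[%classic.
  apply/setIidr => t; rewrite /= !in_itv/= !andbT; exact: lt_le_trans.
pose g1 : R -> R := g \_ (`[1, +oo[%classic : set R).
have ig1 : mu.-integrable D (EFin \o g1).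
  have /integrable_restrict : mu.-integrable (D `&` (`[1, +oo[%classic : set R)) (EFin \o
      g) by rewrite D1.
  by rewrite -restrict_EFin; exact.
have Ig1 : \int[mu]_(t in D) g1 t <= 2 * tau.
  by rewrite -Rintegral_mkcondr D1.
have iB : mu.-integrable D (EFin \o (fun t => tau * dens t + M * g1 t)).
  rewrite (_ : _ \o _ = (fun t => tau%:E * (EFin \o dens) t) \+ (fun t => M%:E * (EFin \o
      g1) t))%E//.
  by apply: integrableD => //; exact: integrableZl.
apply: (@le_trans _ _ (\int[mu]_(t in D) (tau * dens t + M * g1 t))).
  apply: le_Rintegral => //; first exact: integrable_shrinkage_weight.
  move=> t; rewrite /= in_itv/= andbT => tp.
  have op := one_plus_gt0 tau tp.
  have tt : 0 <= t * tau ^+ 2 by rewrite (mulr_ge0 (ltW tp) (sqr_ge0 _)).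
  have dp := onegroup_dens_ge0 tp.
  rewrite posterior_weightE /g1 patchE.
  case: ifPn => [|]; rewrite ?inE ?notin_setE /= in_itv/= andbT.
    move=> t1; apply: (@le_trans _ _ (M * g t)); last by rewrite lerDr mulr_ge0// ltW.
    set r := Num.sqrt t; set v := Num.sqrt (1 + t * tau ^+ 2).
    have r0 : 0 < r by rewrite sqrtr_gt0.
    have v0 : 0 < v by rewrite sqrtr_gt0.
    have r2 : r ^+ 2 = t by rewrite sqr_sqrtr// ltW.
    have v2 : v ^+ 2 = 1 + t * tau ^+ 2 by rewrite sqr_sqrtr// ltW.
    have dle : dens t <= M / r ^+ 3 by apply: onegroup_dens_le => //; rewrite r2.
    have lle : likelihood x tau t <= v^-1.
      rewrite /likelihood powRN powR12_sqrt ?(ltW op)// -/v ler_piMr ?invr_ge0 ?(ltW v0)//.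
      rewrite -[leRHS]expR0 ler_expR mulNr oppr_le0 divr_ge0 ?sqr_ge0//.
      by rewrite mulr_ge0// ltW.
    have -> : M * g t = t * tau ^+ 2 / (1 + t * tau ^+ 2) * (v^-1 * (M / r ^+ 3)).
      by rewrite /g -/v -/r -v2 -{1}r2; field; rewrite !gt_eqF.
    apply: ler_wpM2l; first by rewrite divr_ge0// ltW.
    by apply: ler_pM => //; exact: likelihood_ge0.
  (* Outside [[1, +oo[] the restriction [g1] takes the default value [point], which is 0 in [R]. *)
  move/negP; rewrite -ltNge => t1; rewrite (_ : point = 0)// mulr0 addr0 mulrA ler_wpM2r//.
  apply: (@le_trans _ _ (t * tau ^+ 2 / (1 + t * tau ^+ 2))).
    by rewrite ler_piMr ?likelihood_le1// divr_ge0// ltW.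
  rewrite ler_pdivrMr//.
  apply: (@le_trans _ _ (1 * tau ^+ 2)); first by rewrite ler_wpM2r ?sqr_ge0// ltW.
  rewrite mul1r expr2 ler_pM2l//; apply: (le_trans tau1); rewrite lerDl//.
have i1 : mu.-integrable D (EFin \o (fun t => tau * dens t)).
  rewrite (_ : _ \o _ = (fun t => tau%:E * (EFin \o dens) t)%E)//; exact: integrableZl.
have i2 : mu.-integrable D (EFin \o (fun t => M * g1 t)).
  rewrite (_ : _ \o _ = (fun t => M%:E * (EFin \o g1) t)%E)//; exact: integrableZl.
rewrite RintegralD// !RintegralZl// -/J.
have := ler_wpM2l (ltW M_gt0) Ig1; lra.
Qed.

(** A weight above 1/2 means [den < 2 * num]; the bounds on both integrals then give
    [c * expR (- x ^+ 2 / 2) < 2 * C * tau]. *)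
Lemma shrinkage_gt_half_lower : exists2 c : R, 0 < c & forall x tau,
  0 < tau -> tau <= 1 -> 1 / 2 < posterior_shrinkage (1 / 2) L x tau ->
  c < tau * expR (x ^+ 2 / 2).
Proof.
have [c c0' Hc] := posterior_weight_integral_ge.
have [C C0 HC] := shrinkage_integral_le.
exists (c / (2 * C)); first by rewrite divr_gt0// mulr_gt0.
move=> x tau tau0 tau1; rewrite /posterior_shrinkage.
have := Hc x tau (ltW tau0) tau1; have := HC x tau tau0 tau1.
set num := \int[mu]_(t in D) _; set den := \int[mu]_(t in D) _ => hn hd.
have e0 : 0 < expR (- x ^+ 2 / 2) :> R by exact: expR_gt0.
have den0 : 0 < den by apply: lt_le_trans hd; exact: mulr_gt0.
rewrite ltr_pdivlMr// => h.
rewrite ltr_pdivrMr ?mulr_gt0//.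
have ee : expR (x ^+ 2 / 2) * expR (- x ^+ 2 / 2) = 1 :> R.
  by rewrite -expRD mulNr subrr expR0.
rewrite -(ltr_pM2r e0).
have -> : tau * expR (x ^+ 2 / 2) * (2 * C) * expR (- x ^+ 2 / 2) =
  2 * (C * tau) * (expR (x ^+ 2 / 2) * expR (- x ^+ 2 / 2)) by ring.
rewrite ee; lra.
Qed.

Lemma half_lt_ratio (a b : R) : 0 < b -> b < 2 * a -> 1 / 2 < a / b.
Proof. by move=> b0 h; rewrite ltr_pdivlMr//; lra. Qed.

(** Here [2 * u] is the gain from the region [I] and [a], [b] are the two error terms; each error
    costs less than half of the gain. *)
Lemma lt_combine (u a b x y : R) : a < u -> b < u -> 2 * u + x <= 2 * y + (a + b) ->
  x < 2 * y.
Proof. lra. Qed.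

Lemma expR_half_le2 : expR (2^-1) <= 2 :> R.
Proof.
have h : 2^-1 <= expR (- 2^-1) :> R.
  by apply: le_trans (expR_ge1Dx _); lra.
by rewrite -[leLHS]invrK -expRN -[leRHS]invrK lef_pV2 ?posrE ?expR_gt0 ?invr_gt0.
Qed.

(** With [s = t * tau ^+ 2], passing from [1 / (1 + s)] to 1 in the exponent costs
    [x ^+ 2 * s / (2 * (1 + s)) <= 1 / 2], a factor at most 2. *)
Lemma likelihood_le_near x tau t : 0 < t -> x ^+ 2 * (t * tau ^+ 2) <= 1 ->
  likelihood x tau t <= 2 * expR (- x ^+ 2 / 2).
Proof.
move=> tp h; apply: le_trans (likelihood_le x tau tp) _.
have op := one_plus_gt0 tau tp.
apply: (@le_trans _ _ (expR (2^-1) * expR (- x ^+ 2 / 2))); last first.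
  by rewrite ler_wpM2r ?expR_ge0 ?expR_half_le2.
rewrite -expRD ler_expR ler_pdivrMr ?mulr_gt0//.
set s := t * tau ^+ 2 in h op *.
have s0 : 0 <= s by rewrite (mulr_ge0 (ltW tp) (sqr_ge0 _)).
have := mulr_ge0 (sqr_ge0 x) s0; move: (x ^+ 2) h => z h.
nra.
Qed.

(* With [s = t tau ^ 2], the two correction terms on the right absorb the region
   [s <= 1] (split at [s = 1 / y ^ 2]); the indicator of [I] on the left is a lower
   bound for [(s - 1) / (s + 1) * w] on [y ^ 2 <= s <= 2 y ^ 2]. *)
Lemma shrinkage_pointwise x tau t : 0 < tau -> tau <= 1 -> 2 <= `|x| -> t0 <= `|x| -> 0 < t ->
  let y := `|x| in let w := posterior_weight (1 / 2) L x tau in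
  let I := `[y ^+ 2 / tau ^+ 2, 2 * y ^+ 2 / tau ^+ 2]%classic : set R in
  let T := `]0, 1 / tau ^+ 2]%classic : set R in
  c0 * tau ^+ 3 / (2 ^+ 7 * y ^+ 4) * \1_I t + w t <=
  2 * (t * tau ^+ 2 / (1 + t * tau ^+ 2) * w t) +
  (2 * expR (- x ^+ 2 / 2) * dens t +
   M * (y ^+ 3 * tau ^+ 3) * expR (- x ^+ 2 / 4) * \1_T t).
Proof.
move=> tau0 tau1.
have xy : x ^+ 2 = `|x| ^+ 2 by rewrite real_normK ?num_real.
move: xy; set y := `|x| => xy y2 yt0 tp; cbv zeta.
set w := posterior_weight (1 / 2) L x tau.
set I := (`[_, _]%classic : set R); set T := (`]_, _]%classic : set R).
set e2 := expR (- x ^+ 2 / 2); set e4 := expR (- x ^+ 2 / 4).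
set c' := _ / (_ * y ^+ 4); set b' := _ * e4.
pose sw t := t * tau ^+ 2 / (1 + t * tau ^+ 2) * w t; rewrite -/(sw t).
have y1 : 1 <= y by lra.
have y0 : 0 < y by lra.
have e20 : 0 < e2 by exact: expR_gt0.
have e40 : 0 < e4 by exact: expR_gt0.
have tt : 0 < tau ^+ 2 by rewrite exprn_gt0.
have b'0 : 0 <= b' by rewrite !mulr_ge0 ?exprn_ge0 ?(ltW M_gt0) ?(ltW y0) ?(ltW tau0) ?(ltW
    e40).
have op := one_plus_gt0 tau tp.
pose s := t * tau ^+ 2.
have s0 : 0 <= s by rewrite (mulr_ge0 (ltW tp) (sqr_ge0 _)).
have d0 := onegroup_dens_ge0 tp.
have l0 := likelihood_ge0 x tau t.
have wE : w t = likelihood x tau t * dens t by [].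
have w0 : 0 <= w t by rewrite wE mulr_ge0.
have ed0 : 0 <= 2 * e2 * dens t by rewrite mulr_ge0// mulr_ge0// ltW.
have swE : sw t = s / (1 + s) * w t by [].
have [s1|s1] := ltP s 1.
  have -> : \1_I t = 0 :> R.
    rewrite indicE memNset// /I/= in_itv/= => /andP[].
    rewrite ler_pdivrMr// -/s => ys _; have : 1 <= y ^+ 2 by rewrite expr2 mulr_ege1.
    lra.
  have -> : \1_T t = 1 :> R.
    rewrite indicE mem_set// /T/= in_itv/= tp ler_pdivlMr// -/s ltW//.
  rewrite mulr0 add0r mulr1 ler_wpDl//.
    by rewrite swE mulr_ge0// mulr_ge0// divr_ge0// ltW.
  rewrite wE; have [sy|sy] := leP (x ^+ 2 * s) 1.
    rewrite ler_wpDr// ler_wpM2r//; exact: likelihood_le_near.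
  (* Here [1 / y ^ 2 < s < 1]: the first inequality gives [dens t <= M * (y * tau) ^+ 3], the second
     gives [1 / (2 * (1 + s)) >= 1 / 4] and hence [e4]. *)
  rewrite ler_wpDl// /b' mulrC ler_pM//.
    rewrite (_ : M * _ = M / (y * tau)^-1 ^+ 3); last first.
      by rewrite exprVn invrK exprMn.
    apply: onegroup_dens_le; first by rewrite invr_gt0 mulr_gt0.
    rewrite exprVn -[leLHS]mul1r ler_pdivrMr ?exprn_gt0 ?mulr_gt0//.
    by rewrite exprMn -xy; move: sy; rewrite /s; lra.
  apply: le_trans (likelihood_le x tau tp) _.
  rewrite ler_expR !mulNr lerN2 ler_wpM2l ?sqr_ge0// lef_pV2 ?posrE ?mulr_gt0// -/s.
  lra.
(* From [s >= 1] on, the shrinkage factor is at least 1/2, so no correction term is called upon. *)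
have sw1 : w t <= 2 * sw t.
  rewrite swE mulrA ler_peMl// mulrA ler_pdivlMr// -/s; lra.
have [tI|tI] := boolP (t \in I); last first.
  rewrite indicE (negbTE tI) mulr0 add0r (le_trans sw1)// lerDl addr_ge0//.
  by rewrite mulr_ge0// indicE; case: (t \in T).
rewrite indicE tI mulr1.
apply: (@le_trans _ _ (2 * sw t)); last first.
  by rewrite lerDl addr_ge0// mulr_ge0// indicE; case: (t \in T).
move: tI; rewrite inE /I/= in_itv/= => /andP[].
rewrite ler_pdivrMr// ler_pdivlMr// -/s => ys sy.
have yy : 2 * y <= y ^+ 2 by rewrite expr2 ler_wpM2r// ltW.
(* On [I] one has [s >= y ^+ 2 >= 4], so [2 * s / (1 + s) - 1 = (s - 1) / (s + 1)] exceeds 1/4. *)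
have h3 : 4^-1 * w t <= 2 * sw t - w t.
  rewrite swE mulrA -[X in _ - X]mul1r -mulrBl ler_wpM2r//.
  rewrite mulrA lerBrDr ler_pdivlMr -/s; first lra.
  by rewrite -/s in op.
suff : c' <= 4^-1 * w t by lra.
(* Lower bounds of the three factors of [w] on [I]: [1 + s <= (2 * y) ^+ 2], the exponent is at
   least -1/2, and [t <= (2 * y / tau) ^+ 2]. *)
have -> : c' = 4^-1 * (((2 * y)^-1 * 2^-1) * (c0 / (2 * y / tau) ^+ 3)).
  by rewrite /c'; field; rewrite !gt_eqF.
rewrite ler_pM2l ?invr_gt0// wE; apply: ler_pM.
- by rewrite mulr_ge0// invr_ge0 mulr_ge0// ltW.
- by rewrite divr_ge0 ?(ltW c0_gt0)// exprn_ge0// divr_ge0 ?(ltW tau0)// mulr_ge0// ltW.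
- apply: ler_pM; rewrite ?invr_ge0 ?mulr_ge0 ?(ltW y0)//.
    rewrite powRN powR12_sqrt ?(ltW op)// lef_pV2 ?posrE ?sqrtr_gt0 ?mulr_gt0//.
    rewrite -[leRHS]ger0_norm ?mulr_ge0 ?(ltW y0)// -sqrtr_sqr ler_wsqrtr// -/s.
    by rewrite exprMn; lra.
  apply: (@le_trans _ _ (expR (- 2^-1))).
    by rewrite expRN lef_pV2 ?posrE ?expR_gt0// expR_half_le2.
  rewrite ler_expR mulNr lerN2 ler_pdivrMr ?mulr_gt0// -/s xy.
  lra.
- apply: onegroup_dens_ge.
  + apply: (le_trans yt0); apply: (@le_trans _ _ (y ^+ 2)); first lra.
    apply: (le_trans ys); rewrite /s ler_piMr ?(ltW tp)// expr_le1 ?(ltW tau0)//.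
  + by rewrite divr_gt0// mulr_gt0.
  + rewrite expr_div_n ler_pdivlMr// -/s exprMn; apply: (le_trans sy).
    rewrite ler_wpM2r ?sqr_ge0//; lra.
Qed.

(** Integrate [shrinkage_pointwise]. The interval [I] has length [y ^+ 2 / tau ^+ 2] and yields a
    gain of order [tau / y ^+ 2]; each of the last two hypotheses puts one error term below half of
    it. *)
Lemma shrinkage_gt_half_upper : exists2 C : R, 0 < C & forall x tau,
  0 < tau -> tau <= 1 -> C <= `|x| ->
  C * (`|x| ^+ 2 * expR (- x ^+ 2 / 2)) < tau ->
  C * (`|x| ^+ 5 * expR (- x ^+ 2 / 4)) < 1 ->
  1 / 2 < posterior_shrinkage (1 / 2) L x tau.
Proof.
pose J := \int[mu]_(t in D) dens t.
have [iJ J0] := onegroup_dens_integral.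
have c0n : c0 != 0 by rewrite gt_eqF.
have J' : 0 < 2 ^+ 9 * J / c0 by rewrite divr_gt0// mulr_gt0// exprn_gt0.
have M' : 0 < 2 ^+ 8 * M / c0 by rewrite divr_gt0// mulr_gt0// exprn_gt0.
(* One summand per requirement: [y >= 2], [y >= t0], the mass near 0, and the middle range of
   [s]. *)
exists (2 + t0 + 2 ^+ 9 * J / c0 + 2 ^+ 8 * M / c0).
  by have := t0_gt0; lra.
move=> x tau tau0 tau1.
have xy : x ^+ 2 = `|x| ^+ 2 by rewrite real_normK ?num_real.
move: xy; set y := `|x| => xy yC h1 h2.
have y2 : 2 <= y by have := t0_gt0; lra.
have yt0 : t0 <= y by lra.
have y0 : 0 < y by lra.
set e2 := expR (- x ^+ 2 / 2) in h1; set e4 := expR (- x ^+ 2 / 4) in h2.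
have e20 : 0 < e2 by exact: expR_gt0.
have e40 : 0 < e4 by exact: expR_gt0.
have {}h1 : 2 * e2 * J < c0 * tau / (2 ^+ 8 * y ^+ 2).
  rewrite ltr_pdivlMr ?mulr_gt0 ?exprn_gt0//.
  have : (2 ^+ 9 * J / c0) * (y ^+ 2 * e2) < tau.
    apply: le_lt_trans h1; rewrite ler_pM2r ?mulr_gt0 ?exprn_gt0//.
    by have := t0_gt0; lra.
  rewrite -(ltr_pM2l c0_gt0) (_ : c0 * (2 ^+ 9 * J / c0 * (y ^+ 2 * e2)) = 2 * e2 * J * (2
      ^+ 8 * y ^+ 2))//.
  by field.
have {}h2 : M * y ^+ 3 * e4 < c0 / (2 ^+ 8 * y ^+ 2).
  rewrite ltr_pdivlMr ?mulr_gt0 ?exprn_gt0//.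
  have : (2 ^+ 8 * M / c0) * (y ^+ 5 * e4) < 1.
    apply: le_lt_trans h2; rewrite ler_pM2r ?mulr_gt0 ?exprn_gt0//.
    by have := t0_gt0; lra.
  rewrite -(ltr_pM2l c0_gt0) mulr1 (_ : c0 * (2 ^+ 8 * M / c0 * (y ^+ 5 * e4)) = M * y ^+
      3 * e4 * (2 ^+ 8 * y ^+ 2))//.
  by field.
pose I : set R := `[y ^+ 2 / tau ^+ 2, 2 * y ^+ 2 / tau ^+ 2]%classic.
pose T : set R := `]0, 1 / tau ^+ 2]%classic.
have tt : 0 < tau ^+ 2 by rewrite exprn_gt0.
have ty : 0 < y ^+ 2 / tau ^+ 2 by rewrite divr_gt0 ?exprn_gt0.
have muI : mu I = (y ^+ 2 / tau ^+ 2)%:E.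
  rewrite /I lebesgue_measure_itv/= lte_fin -mulrA ltr_pMl// ltr1n -EFinB.
  by congr (_%:E); ring.
have muT : mu T = (1 / tau ^+ 2)%:E.
  by rewrite /T lebesgue_measure_itv/= lte_fin divr_gt0// -EFinB subr0.
have ID : I `<=` D.
  by move=> t; rewrite /I/= !in_itv/= andbT => /andP[+ _]; exact: lt_le_trans.
have TD : T `<=` D by move=> t; rewrite /T/= !in_itv/= andbT => /andP[].
pose c' := c0 * tau ^+ 3 / (2 ^+ 7 * y ^+ 4).
pose b' := M * (y ^+ 3 * tau ^+ 3) * e4.
have b'0 : 0 <= b' by rewrite !mulr_ge0 ?exprn_ge0 ?(ltW M_gt0) ?(ltW y0) ?(ltW tau0) ?(ltW
    e40).
have [iI II] := @Rintegral_cst_indic I c' _ (measurable_itv _) ID muI.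
have [iT IT] := @Rintegral_cst_indic T b' _ (measurable_itv _) TD muT.
pose w := posterior_weight (1 / 2) L x tau.
pose sw t := t * tau ^+ 2 / (1 + t * tau ^+ 2) * w t.
have iw : mu.-integrable D (EFin \o w) by exact: integrable_posterior_weight.
have isw : mu.-integrable D (EFin \o sw) by exact: integrable_shrinkage_weight.
have key t : 0 < t -> c' * \1_I t + w t <= 2 * sw t + (2 * e2 * dens t + b' * \1_T t).
  by move=> tp; exact: shrinkage_pointwise.
have i2 : mu.-integrable D (EFin \o (fun t => 2 * sw t)).
  by rewrite (_ : _ \o _ = (fun t => 2%:E * (EFin \o sw) t)%E)//; exact: integrableZl.
have i3 : mu.-integrable D (EFin \o (fun t => 2 * e2 * dens t)).
  by rewrite (_ : _ \o _ = (fun t => (2 * e2)%:E * (EFin \o dens) t)%E)//; exact: integrableZl.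
have i4 : mu.-integrable D (EFin \o (fun t => 2 * e2 * dens t + b' * \1_T t)).
  by rewrite (_ : _ \o _ = (EFin \o (fun t => (2 * e2 * dens t)%R)) \+ (EFin \o (fun t =>
      (b' * \1_T t)%R)))%E//; exact: integrableD.
have i5 : mu.-integrable D (EFin \o (fun t => 2 * sw t + (2 * e2 * dens t + b' * \1_T t))).
  by rewrite (_ : _ \o _ = (EFin \o (fun t => (2 * sw t)%R)) \+ (EFin \o (fun t => (2 *
      e2 * dens t + b' * \1_T t)%R)))%E//; exact: integrableD.
have i6 : mu.-integrable D (EFin \o (fun t => c' * \1_I t + w t)).
  by rewrite (_ : _ \o _ = (EFin \o (fun t => (c' * \1_I t)%R)) \+ (EFin \o w))%E//;
      exact: integrableD.
have : \int[mu]_(t in D) (c' * \1_I t + w t) <=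
       \int[mu]_(t in D) (2 * sw t + (2 * e2 * dens t + b' * \1_T t)).
  by apply: le_Rintegral => // t; rewrite /= in_itv/= andbT; exact: key.
rewrite (RintegralD _ iI iw)// (RintegralD _ i2 i4)// (RintegralD _ i3 iT)//.
have E1 : \int[mu]_(t in D) (2 * sw t) = 2 * \int[mu]_(t in D) sw t by exact: RintegralZl.
have E2 : \int[mu]_(t in D) (2 * e2 * dens t) = 2 * e2 * J by exact: RintegralZl.
rewrite II IT E1 E2 => hmain.
have wpos : 0 < \int[mu]_(t in D) w t.
  have [c cpos Hc] := posterior_weight_integral_ge.
  by apply: lt_le_trans (Hc x tau (ltW tau0) tau1); exact: mulr_gt0 cpos (expR_gt0 _).
suff : \int[mu]_(t in D) w t < 2 * \int[mu]_(t in D) sw t.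
  exact: half_lt_ratio.
have hc : c' * (y ^+ 2 / tau ^+ 2) = 2 * (tau * (c0 / (2 ^+ 8 * y ^+ 2))).
  by rewrite /c'; field; rewrite !gt_eqF.
have hb : b' * (1 / tau ^+ 2) = tau * (M * y ^+ 3 * e4).
  by rewrite /b'; field; rewrite !gt_eqF.
have hk : c0 * tau / (2 ^+ 8 * y ^+ 2) = tau * (c0 / (2 ^+ 8 * y ^+ 2)) by ring.
rewrite hk in h1; rewrite hc hb in hmain.
have h4 : tau * (M * y ^+ 3 * e4) < tau * (c0 / (2 ^+ 8 * y ^+ 2)) by rewrite ltr_pM2l.
exact: lt_combine h1 h4 hmain.
Qed.

End posterior.

(** * Risk bounds at fixed n *)

Section exceedance.
Context {R : realType}.
Local Notation Phi := (@std_normal_cdf R).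
Implicit Types t s : R.

Definition exceed t s : set R := [set e | s < `|t + e|].

Lemma exceedE t s : exceed t s = `]-oo, (- s - t)[ `|` `](s - t), +oo[.
Proof.
apply/seteqP; split => e; rewrite /exceed/= !in_itv/= ?andbT -/(s < `|t + e|) ltr_normr.
  by case/orP => h; [right|left]; lra.
by case => h; apply/orP; [right|left]; lra.
Qed.

Lemma measurable_exceed t s : measurable (exceed t s).
Proof. by rewrite exceedE; exact: measurableU. Qed.

Definition exceed_prob t s : R := fine (normal_prob 0 1 (exceed t s)).

Lemma exceed_probE t s : (exceed_prob t s)%:E = normal_prob 0 1 (exceed t s).
Proof. by apply: fine_normal_probK; exact: measurable_exceed. Qed.

Lemma exceed_prob_ge0 t s : 0 <= exceed_prob t s.
Proof. by rewrite fine_ge0. Qed.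

Lemma exceed_prob_le1 t s : exceed_prob t s <= 1.
Proof. by rewrite -lee_fin exceed_probE normal_prob_le1//; exact: measurable_exceed. Qed.

Lemma exceed_prob_le t s : exceed_prob t s <= Phi (- t - s) + Phi (t - s).
Proof.
rewrite -lee_fin exceed_probE EFinD exceedE.
rewrite (_ : - t - s = - s - t) 1?addrC// -normal_prob_Nyo -(opprB s t) -normal_prob_oy.
exact: measureU2.
Qed.

(** Of the two half-lines making up the event, keep the one on the side of the sign of [t]. *)
Lemma exceed_prob_ge t s : Phi (`|t| - s) <= exceed_prob t s.
Proof.
rewrite -lee_fin exceed_probE exceedE.
case: (ler0P t) => t0.
  rewrite (_ : - t - s = - s - t) 1?addrC// -normal_prob_Nyo.
  by rewrite le_measure ?inE//; exact: measurableU.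
rewrite -(opprB s t) -normal_prob_oy.
by rewrite le_measure ?inE//; exact: measurableU.
Qed.

End exceedance.

(** * Error rates of rules bracketed by two thresholds *)

Section risk_bounds.
Context {d} {T : measurableType d} {R : realType} {P : probability T R} {n : nat}.
Variable eps : 'I_n -> {RV P >-> R}.
Hypothesis eps_normal : forall i, has_std_normal_law (eps i).
Hypothesis eps_indep : mutually_independent eps.
Local Notation Phi := (@std_normal_cdf R).
Local Notation X := (observation eps).
Implicit Types (theta : 'rV[R]_n) (s : R).

Lemma observation_exceedE theta s i (w : T) :
  (s < `|X theta w 0 i|)%R%:R = \1_(eps i @^-1` exceed (theta 0 i) s) w :> R.
Proof. by rewrite indicE mxE; congr (nat_of_bool _)%:R; apply/idP/idP; rewrite inE. Qed.

Lemma measurable_eps_preimage i (A : set R) : measurable A ->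
  measurable (eps i @^-1` A).
Proof. by move=> mA; rewrite -[_ @^-1` _]setTI; exact: measurable_funP. Qed.

Lemma has_mean_exceed theta s i :
  has_mean P (fun w => (s < `|X theta w 0 i|)%R%:R) (exceed_prob (theta 0 i) s).
Proof.
under eq_fun do rewrite observation_exceedE.
rewrite /exceed_prob -(eps_normal i (measurable_exceed _ _)).
by apply: has_mean_indic; apply: measurable_eps_preimage; exact: measurable_exceed.
Qed.

(** The product of indicators is the indicator of an intersection, to which mutual independence
    applies with the pair [{i, j}]. *)
Lemma has_mean_exceedM theta s i j : i != j ->
  has_mean P (fun w => (s < `|X theta w 0 i|)%R%:R * (s < `|X theta w 0 j|)%R%:R)
    (exceed_prob (theta 0 i) s * exceed_prob (theta 0 j) s).
Proof.
move=> ij.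
pose A k := exceed (theta 0 k) s.
have mA k : measurable (A k) by exact: measurable_exceed.
rewrite (_ : (fun w => _) = \1_(\bigcap_(k in [set` [set i; j]%SET]) (eps k @^-1` A k)));
    last first.
  apply/funext => w; rewrite !observation_exceedE -[RHS]/(\1__ w) !indicE.
  rewrite -natrM mulnb; congr (nat_of_bool _)%:R; apply/andP/idP.
    rewrite !inE => -[wi wj] k /=; rewrite !inE => /orP[] /eqP -> //.
  by move/set_mem => h; split; apply/mem_set; apply: h; rewrite /= !inE eqxx ?orbT.
have := eps_indep [set i; j]%SET mA.
rewrite big_setU1/= ?inE// big_set1.
rewrite -![P (_ @^-1` _)]/(distribution _ _ _) !eps_normal// -!exceed_probE => PA.
rewrite -[_ * _]/(fine (_%:E)) EFinM -PA; apply: has_mean_indic.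
apply: fin_bigcap_measurable => // k _; exact: measurable_eps_preimage.
Qed.

(** After expansion, off-diagonal means factor and cancel; on the diagonal an indicator equals its
    square, which leaves a Bernoulli variance. *)
Lemma has_mean_exceed_cov theta s i j :
  has_mean P (fun w => ((s < `|X theta w 0 i|)%R%:R - exceed_prob (theta 0 i) s) *
                       ((s < `|X theta w 0 j|)%R%:R - exceed_prob (theta 0 j) s))
    (if i == j then exceed_prob (theta 0 i) s * (1 - exceed_prob (theta 0 i) s) else 0).
Proof.
set p := exceed_prob _ _; set r := exceed_prob _ _.
pose Y k w : R := (s < `|X theta w 0 k|)%R%:R.
rewrite (_ : (fun w => _) = (fun w => (Y i w * Y j w - (r * Y i w + p * Y j w)) + cst (p *
    r) w)); last first.
  by apply/funext => w; rewrite /Y/=; ring.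
have Yi := has_mean_exceed theta s i; have Yj := has_mean_exceed theta s j.
have h e : has_mean P (fun w => Y i w * Y j w) e ->
    has_mean P (fun w => (Y i w * Y j w - (r * Y i w + p * Y j w)) + cst (p * r) w)
      (e - (r * p + p * r) + p * r).
  move=> Ye; apply: has_meanD (has_mean_cst _ _).
  by apply: has_meanB Ye _; apply: has_meanD; exact: has_meanZ.
case: eqVneq => [ij|ij].
  have -> : p * (1 - p) = p - (r * p + p * r) + p * r.
    by rewrite /r -ij -/p; ring.
  apply: h; rewrite (_ : (fun w => _) = Y i)//.
  by apply/funext => w; rewrite /Y -ij; case: (_ < _); rewrite ?mulr0 ?mulr1.
have -> : 0 = p * r - (r * p + p * r) + p * r by ring.
by apply: h; exact: has_mean_exceedM.
Qed.

Lemma sum_supp theta (F : 'I_n -> R) :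
  \sum_(i < n | theta 0 i != 0) F i = \sum_(i in supp theta) F i.
Proof. by apply: eq_bigl => i; rewrite inE. Qed.

(** A missed signal cannot have exceeded [s], and a signal of size at least [m] exceeds [s] with
    probability at least [Phi (m - s)]. *)
Lemma FNR_le theta (psi : 'rV[R]_n -> 'I_n -> bool) (m s : R) :
  (0 < #|supp theta|)%N ->
  (forall i, i \in supp theta -> m <= `|theta 0 i|) ->
  (forall (x : 'rV[R]_n) i, s < `|x 0 i| -> psi x i) ->
  (FNR eps theta psi <= (1 - Phi (m - s))%:E)%E.
Proof.
move=> q0 mt spsi; set q := #|supp theta| in q0.
have q1 : 0 < q%:R :> R by rewrite ltr0n.
pose g w : R := q%:R^-1 * \sum_(i < n | theta 0 i != 0) (1 - (s < `|X theta w 0 i|)%R%:R).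
have mg : has_mean P g (q%:R^-1 * \sum_(i < n | theta 0 i != 0) (1 - exceed_prob (theta 0
    i) s)).
  apply/has_meanZ/has_mean_sum => i _.
  by apply: has_meanB (has_mean_cst _ 1) _; exact: has_mean_exceed.
apply: (@le_trans _ _ (q%:R^-1 * \sum_(i < n | theta 0 i != 0) (1 - exceed_prob (theta 0 i)
    s))%:E).
  apply: (expectation_le_mean mg) => w.
  rewrite /fnp /g mulrC -/q (max_l _) ?ler1n//.
  rewrite ler_pM2l ?invr_gt0//; apply: ler_sum => i _.
  rewrite lerD2l lerN2 ler_nat.
  by case: (ltP s) => // h; rewrite spsi.
rewrite lee_fin mulrC ler_pdivrMr// sum_supp.
rewrite /q -sum1_card natr_sum mulr_sumr.
apply: ler_sum => i iS; rewrite mulr1 lerD2l lerN2.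
by apply: le_trans (exceed_prob_ge _ _); rewrite le_std_normal_cdf// lerD2r mt.
Qed.

(** The signals contribute at most their number. So as soon as at most [#|supp theta|] nulls exceed
    [t0], the total is at most twice that, as the selection hypotheses below require. *)
Lemma exceed_null_count theta (t0 : R) (w : T) :
  \sum_(j < n) (t0 < `|X theta w 0 j|)%R%:R <=
  #|supp theta|%:R + \sum_(j < n | theta 0 j == 0) (t0 < `|X theta w 0 j|)%R%:R :> R.
Proof.
rewrite (bigID (fun j => theta 0 j != 0))/= lerD//.
  rewrite sum_supp -sum1_card natr_sum.
  by apply: ler_sum => i _; rewrite ler_nat leq_b1.
by under eq_bigl do rewrite negbK.
Qed.

Lemma sum_exceed_null_le theta (t0 : R) :
  \sum_(j < n | theta 0 j == 0) exceed_prob (theta 0 j) t0 <= n%:R * (2 * Phi (- t0)).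
Proof.
apply: (@le_trans _ _ (\sum_(j < n | theta 0 j == 0) 2 * Phi (- t0))).
  apply: ler_sum => j /eqP ->; apply: le_trans (exceed_prob_le _ _) _.
  by rewrite oppr0 !sub0r; lra.
have h : 0 <= 2 * Phi (- t0) by rewrite mulr_ge0// std_normal_cdf_ge0.
apply: (@le_trans _ _ (\sum_(j < n) 2 * Phi (- t0))).
  rewrite [leRHS](bigID (fun j => theta 0 j == 0))/= lerDl; exact: sumr_ge0.
by rewrite sumr_const card_ord -[leLHS]mulr_natl.
Qed.

(** Pointwise [fnp >= (F - N0) / q], with [F] the number of signals not exceeding [s] and [N0] the
    number of nulls beyond [t0]. If [N0 <= q], selected signals exceed [s]; otherwise the right side
    is nonpositive, since [F <= q]. *)
Lemma FNR_ge theta (psi : 'rV[R]_n -> 'I_n -> bool) (m s t0 : R) :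
  (0 < #|supp theta|)%N ->
  (forall i, i \in supp theta -> theta 0 i = - m) ->
  (forall (x : 'rV[R]_n) i, \sum_(j < n) (t0 < `|x 0 j|)%R%:R <= 2 * #|supp theta|%:R :> R ->
    psi x i -> s < `|x 0 i|) ->
  ((1 - Phi (m - s) - Phi (- m - s) - 2 * (n%:R / #|supp theta|%:R) * Phi (- t0))%:E
    <= FNR eps theta psi)%E.
Proof.
move=> q0 mt psis; set q := #|supp theta| in q0 psis *.
have q1 : 0 < q%:R :> R by rewrite ltr0n.
pose N0 w : R := \sum_(j < n | theta 0 j == 0) (t0 < `|X theta w 0 j|)%R%:R.
have N00 w : 0 <= N0 w by exact: sumr_ge0.
pose F w : R := \sum_(i < n | theta 0 i != 0) (1 - (s < `|X theta w 0 i|)%R%:R).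
pose g w : R := q%:R^-1 * (F w - N0 w).
pose e : R := q%:R^-1 * (\sum_(i < n | theta 0 i != 0) (1 - exceed_prob (theta 0 i) s) -
  \sum_(j < n | theta 0 j == 0) exceed_prob (theta 0 j) t0).
have mg : has_mean P g e.
  apply/has_meanZ/has_meanB; apply: has_mean_sum => i _; last exact: has_mean_exceed.
  by apply: has_meanB (has_mean_cst _ 1) _; exact: has_mean_exceed.
apply: (@le_trans _ _ e%:E); last first.
  apply: (mean_le_expectation mg) => w.
  rewrite /fnp /g -/q (max_l _) ?ler1n// [leRHS]mulrC ler_pM2l ?invr_gt0//.
  have [Nq|qN] := leP (N0 w) q%:R.
    apply: (@le_trans _ _ (F w)); first by rewrite gerBl.
    apply: ler_sum => i _; rewrite lerD2l lerN2 ler_nat.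
    case: (boolP (psi _ _)) => // /psis -> //.
    apply: le_trans (exceed_null_count _ _ _) _.
    by rewrite mulr_natl mulr2n lerD2l.
  apply: (@le_trans _ _ 0); last first.
    by apply: sumr_ge0 => i _; rewrite subr_ge0; case: (psi _ _).
  rewrite subr_le0; apply: le_trans (ltW qN).
  rewrite /F sum_supp /q -sum1_card natr_sum; apply: ler_sum => i _.
  by rewrite lerBlDr lerDl.
rewrite lee_fin /e [leRHS]mulrC ler_pdivlMr// sum_supp.
set A := \sum_(i in _) _; set B := \sum_(j < n | _) _.
have hA : (1 - Phi (m - s) - Phi (- m - s)) * q%:R <= A.
  rewrite /q -sum1_card natr_sum mulr_sumr; apply: ler_sum => i /mt ->.
  by rewrite mulr1; have := exceed_prob_le (- m) s; rewrite opprK; lra.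
have hB : B <= n%:R * (2 * Phi (- t0)) by exact: sum_exceed_null_le.
rewrite mulrBl.
have -> : 2 * (n%:R / q%:R) * Phi (- t0) * q%:R = n%:R * (2 * Phi (- t0)).
  by field; rewrite gt_eqF.
lra.
Qed.

(* Write [N0], [V] for the numbers of nulls beyond [t0], [sl], and [W] for the
   centred number of signals beyond [su]. Pointwise
   [fdp <= N0 / q + 4 W ^ 2 / (p ^ 2 q ^ 2) + 2 V / (p q)], according to whether
   [N0 > q], or fewer than [p q / 2] signals are detected, or neither. *)
Lemma FDR_le theta (psi : 'rV[R]_n -> 'I_n -> bool) (m su sl t0 : R) :
  (0 < #|supp theta|)%N ->
  (forall i, i \in supp theta -> m <= `|theta 0 i|) ->
  (forall (x : 'rV[R]_n) i, su < `|x 0 i| -> psi x i) ->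
  (forall (x : 'rV[R]_n) i, \sum_(j < n) (t0 < `|x 0 j|)%R%:R <= 2 * #|supp theta|%:R :> R ->
    psi x i -> sl < `|x 0 i|) ->
  (FDR eps theta psi <= (2 * (n%:R / #|supp theta|%:R) * Phi (- t0) +
     4 / (Phi (m - su) ^+ 2 * #|supp theta|%:R) +
     4 * (n%:R / #|supp theta|%:R) * Phi (- sl) / Phi (m - su))%:E)%E.
Proof.
move=> q0 mt supsi psis; set q := #|supp theta| in q0 psis *.
have q1 : 0 < q%:R :> R by rewrite ltr0n.
set p := Phi (m - su); have p0 : 0 < p by exact: std_normal_cdf_gt0.
pose pr i := exceed_prob (theta 0 i) su.
have prp i : i \in supp theta -> p <= pr i.
  move=> iS; apply: le_trans (exceed_prob_ge _ _).
  by rewrite le_std_normal_cdf// lerD2r mt.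
pose Y i w : R := (su < `|X theta w 0 i|)%R%:R.
pose N0 w : R := \sum_(j < n | theta 0 j == 0) (t0 < `|X theta w 0 j|)%R%:R.
pose V w : R := \sum_(j < n | theta 0 j == 0) (sl < `|X theta w 0 j|)%R%:R.
have N00 w : 0 <= N0 w by exact: sumr_ge0.
have V0 w : 0 <= V w by exact: sumr_ge0.
pose W w : R := \sum_(i in supp theta) (Y i w - pr i).
(* The square of [W], expanded so that its mean is a sum of covariances. *)
pose W2 w : R := \sum_(i in supp theta) \sum_(j in supp theta) (Y i w - pr i) * (Y j w - pr j).
have W2E w : W2 w = W w ^+ 2.
  by rewrite expr2 /W mulr_suml; apply: eq_bigr => i _; rewrite mulr_sumr.
pose g w := q%:R^-1 * N0 w + 4 / (p ^+ 2 * q%:R ^+ 2) * W2 w + 2 / (p * q%:R) * V w.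
pose eW : R := \sum_(i in supp theta) \sum_(j in supp theta)
  (if i == j then pr i * (1 - pr i) else 0).
pose eN s : R := \sum_(j < n | theta 0 j == 0) exceed_prob (theta 0 j) s.
have mg : has_mean P g (q%:R^-1 * eN t0 + 4 / (p ^+ 2 * q%:R ^+ 2) * eW + 2 / (p * q%:R) *
    eN sl).
  apply: has_meanD; first apply: has_meanD; apply: has_meanZ.
  - by apply: has_mean_sum => i _; exact: has_mean_exceed.
  - apply: has_mean_sum => i _; apply: has_mean_sum => j _; exact: has_mean_exceed_cov.
  - by apply: has_mean_sum => i _; exact: has_mean_exceed.
apply: le_trans (expectation_le_mean mg _) _.
  move=> w; rewrite /fdp.
  set num := \sum_(i < n | _) _; set tot := \sum_(i < n) _.
  have num0 : 0 <= num by exact: sumr_ge0.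
  have numtot : num <= tot.
    rewrite /tot (bigID (fun j => theta 0 j == 0))/= lerDl; exact: sumr_ge0.
  have tot1 : 0 < Num.max tot 1 by rewrite lt_max ltr01 orbT.
  have fdp1 : num / Num.max tot 1 <= 1.
    by rewrite ler_pdivrMr// mul1r le_max numtot.
  have h1 : 0 <= q%:R^-1 * N0 w by rewrite mulr_ge0// invr_ge0 ltW.
  have h2 : 0 <= 4 / (p ^+ 2 * q%:R ^+ 2) * W2 w.
    rewrite W2E mulr_ge0 ?sqr_ge0// divr_ge0// mulr_ge0 ?sqr_ge0//.
  have h3 : 0 <= 2 / (p * q%:R) * V w.
    by rewrite mulr_ge0// divr_ge0// mulr_ge0 // ltW.
  rewrite /g; have [Nq|qN] := leP (N0 w) q%:R; last first.
    have : 1 <= q%:R^-1 * N0 w by rewrite mulrC ler_pdivlMr// mul1r ltW.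
    lra.
  pose S := \sum_(i in supp theta) Y i w.
  have [Sq|qS] := ltP S (p * q%:R / 2).
    have : 1 <= 4 / (p ^+ 2 * q%:R ^+ 2) * W2 w.
      rewrite W2E mulrAC ler_pdivlMr ?mul1r ?mulr_gt0 ?exprn_gt0//.
      (* Chebyshev's argument: the mean of [S] is at least [p * q], so [S < p * q / 2] pushes [W]
         below [- (p * q / 2)]. *)
      have WS : W w <= S - p * q%:R.
        rewrite /W sumrB lerD2l lerN2 /q -sum1_card natr_sum mulr_sumr.
        by apply: ler_sum => i iS; rewrite mulr1 prp.
      have : W w <= - (p * q%:R / 2) by lra.
      rewrite -exprMn; have pq0 : 0 < p * q%:R by exact: mulr_gt0.
      move: (p * q%:R) pq0 => z z0 Wz; nra.
    lra.
  have : num / Num.max tot 1 <= 2 / (p * q%:R) * V w.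
    have pq0 : 0 < p * q%:R by exact: mulr_gt0.
    have Stot : S <= tot.
      rewrite /tot (bigID (fun j => theta 0 j != 0))/= ler_wpDr//.
        by apply: sumr_ge0.
      rewrite sum_supp; apply: ler_sum => i _; rewrite /Y ler_nat.
      by case: (ltP su) => // h; rewrite supsi.
    have numV : num <= V w.
      apply: ler_sum => i _; rewrite ler_nat.
      case: (boolP (psi _ _)) => // /psis -> //.
      apply: le_trans (exceed_null_count _ _ _) _.
      by rewrite mulr_natl mulr2n lerD2l.
    rewrite ler_pdivrMr//; apply: (le_trans numV).
    rewrite -[leLHS]mul1r mulrAC ler_wpM2r//.
    rewrite -mulrA [_^-1 * _]mulrC mulrA ler_pdivlMr// mul1r.
    have : p * q%:R / 2 <= Num.max tot 1 by rewrite le_max (le_trans qS).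
    lra.
  lra.
(* Only the diagonal survives, and each Bernoulli variance is at most 1. *)
have hW : eW <= q%:R.
  rewrite /q -sum1_card natr_sum; apply: ler_sum => i iS.
  rewrite (bigD1 i)//= eqxx big1 ?addr0; last first.
    by move=> j /andP[_ /negbTE]; rewrite eq_sym => ->.
  have := exceed_prob_ge0 (theta 0 i) su; have := exceed_prob_le1 (theta 0 i) su.
  rewrite -/(pr i); move: (pr i) => z; nra.
have hN s : eN s <= n%:R * (2 * Phi (- s)) by exact: sum_exceed_null_le.
rewrite lee_fin lerD//; first rewrite lerD//.
- have -> : 2 * (n%:R / q%:R) * Phi (- t0) = q%:R^-1 * (n%:R * (2 * Phi (- t0))) by ring.
  by rewrite ler_pM2l// invr_gt0.
- have -> : 4 / (p ^+ 2 * q%:R) = 4 / (p ^+ 2 * q%:R ^+ 2) * q%:R.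
    by field; rewrite !gt_eqF.
  by rewrite ler_wpM2l// divr_ge0// mulr_ge0 ?sqr_ge0.
- have -> : 4 * (n%:R / q%:R) * Phi (- sl) / p = 2 / (p * q%:R) * (n%:R * (2 * Phi (- sl))).
    by field; rewrite !gt_eqF.
  by rewrite ler_wpM2l// divr_ge0// mulr_ge0 // ltW.
Qed.

End risk_bounds.

(** * Deterministic thresholds and bounds on the estimated scale *)

Section thresholds.
Context {R : realType}.
Implicit Types y C : R.

(** The term of degree [k + 1] of the exponential series beats [y ^+ k] by a factor linear in [y],
    which gives [Y] explicitly. *)
Lemma poly_expR_small (k : nat) (C lam : R) : 0 < C -> 0 < lam ->
  exists2 Y : R, 0 < Y & forall y, Y <= y -> C * (y ^+ k * expR (- (lam * y))) < 1.
Proof.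
move=> C0 l0; pose f : R := (k.+1)`!%:R.
have f0 : 0 < f by rewrite ltr0n fact_gt0.
have Y0 : 0 < C * f / lam ^+ k.+1 by rewrite divr_gt0 ?mulr_gt0 ?exprn_gt0.
exists (C * f / lam ^+ k.+1 + 1); first by rewrite addr_gt0.
move=> y yY; have y0 : 0 < y by apply: lt_le_trans yY; rewrite addr_gt0.
have ly : 0 < lam * y by exact: mulr_gt0.
have h := expR_ge1Dxn k (ltW ly).
have {}h : (lam * y) ^+ k.+1 / f < expR (lam * y) by apply: lt_le_trans h; rewrite ltrDr.
rewrite expRN mulrA ltr_pdivrMr ?expR_gt0// mul1r; apply: le_lt_trans h.
rewrite ler_pdivlMr// exprMn [y ^+ k.+1]exprS.
have -> : C * y ^+ k * f = C * f * y ^+ k by ring.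
rewrite mulrA ler_pM2r ?exprn_gt0//.
have : C * f / lam ^+ k.+1 <= y by apply: le_trans yY; rewrite lerDl.
by rewrite ler_pdivrMr ?exprn_gt0// [y * _]mulrC.
Qed.

(** These are the conditions of [shrinkage_gt_half_upper] at the smallest scale [1 / n]. With
    [a ^+ 2 = 2 * ln n], [y ^+ 2 - a ^+ 2 >= delta * y], so [n * expR (- y ^+ 2 / 2) <= expR (-
    (delta / 2 * y))], which absorbs the polynomial factor. *)
Lemma detection_threshold (C delta : R) : 0 < C -> 0 < delta ->
  exists A : R, forall (n : nat) y, (0 < n)%N -> A <= Num.sqrt (2 * ln n%:R) ->
    Num.sqrt (2 * ln n%:R) + delta < y ->
    [/\ C <= y, C * (y ^+ 2 * expR (- y ^+ 2 / 2)) < 1 / n%:R &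
        C * (y ^+ 5 * expR (- y ^+ 2 / 4)) < 1].
Proof.
move=> C0 d0.
have [Y1 Y10 HY1] := @poly_expR_small 2 C (delta / 2) C0 (divr_gt0 d0 (ltr0n R 2)).
have [Y2 Y20 HY2] := @poly_expR_small 5 C 1 C0 ltr01.
(* The 4 gives [y <= y ^+ 2 / 4], which reduces the last condition to rate 1. *)
exists (C + Y1 + Y2 + 4) => n y n0.
set a := Num.sqrt _ => aA ay.
have nr : 1 <= n%:R :> R by rewrite ler1n.
have ln0 : 0 <= ln n%:R :> R by exact: ln_ge0.
have a2 : a ^+ 2 = 2 * ln n%:R by rewrite sqr_sqrtr// mulr_ge0.
have y4 : 4 <= y by lra.
have y0 : 0 < y by lra.
split; first by lra.
- have Y1y : Y1 <= y by lra.
  have := HY1 y Y1y.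
  rewrite ltr_pdivlMr ?ltr0n//; apply: le_lt_trans.
  rewrite -[X in _ * X <= _](lnK (_ : n%:R \is Num.pos)) ?posrE ?ltr0n//.
  have e : expR (- y ^+ 2 / 2) * expR (ln n%:R) <= expR (- (delta / 2 * y)).
    have : delta * y <= (y - a) * (y + a) by apply: ler_pM; lra.
    by rewrite -subr_sqr a2 -expRD ler_expR; lra.
  rewrite -[leLHS]mulrA ler_pM2l// -[leLHS]mulrA; apply: ler_wpM2l e.
  by rewrite exprn_ge0// ltW.
- have Y2y : Y2 <= y by lra.
  have := HY2 y Y2y; apply: le_lt_trans.
  rewrite ler_pM2l// ler_pM2l ?exprn_gt0// ler_expR mul1r mulNr lerN2.
  by rewrite ler_pdivlMr// expr2 ler_pM2l.
Qed.

Section tau_hat_bounds.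
Variables (c1 c2 : R) (n : nat).
Hypotheses (c2_ge1 : 1 <= c2) (n_gt0 : (0 < n)%N).
Implicit Types (x : 'rV[R]_n).

Lemma tau_hat_ge x : 1 / n%:R <= tau_hat c1 c2 x.
Proof. by rewrite le_max lexx. Qed.

Lemma tau_hat_le x (k : R) : 1 <= k ->
  \sum_(j < n) (Num.sqrt (c1 * ln n%:R) < `|x 0 j|)%R%:R <= k ->
  tau_hat c1 c2 x <= k / n%:R.
Proof.
move=> k1 hk; have nr : 0 < n%:R :> R by rewrite ltr0n.
rewrite ge_max; apply/andP; split; first by rewrite ler_pM2r ?invr_gt0.
have c20 : 0 < c2 by exact: lt_le_trans c2_ge1.
rewrite div1r invfM -mulrA [X in _ * X]mulrC mulrA ler_pM2r ?invr_gt0//.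
apply: le_trans hk; rewrite ler_piMl// ?invf_le1//.
by apply: sumr_ge0 => i _; rewrite ler0n.
Qed.

Lemma tau_hat_gt0 x : 0 < tau_hat c1 c2 x.
Proof. by apply: lt_le_trans (tau_hat_ge x); rewrite divr_gt0// ltr0n. Qed.

Lemma tau_hat_le1 x : tau_hat c1 c2 x <= 1.
Proof.
have nr : 0 < n%:R :> R by rewrite ltr0n.
rewrite -[leRHS](divff (lt0r_neq0 nr)); apply: tau_hat_le; first by rewrite ler1n.
apply: (@le_trans _ _ (\sum_(j < n) 1)); last by rewrite sumr_const card_ord.
by apply: ler_sum => i _; rewrite lern1 leq_b1.
Qed.

End tau_hat_bounds.
End thresholds.

(** * Thresholds bracketing the empirical Bayes rule *)

Section eb_rule_thresholds.
Context {R : realType}.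
Variable L : R -> R.
Hypothesis prior : one_group_prior (1 / 2) L.
Hypothesis A1 : exists c0 t0 : R, [/\ 0 < c0, 0 < t0 & forall t : R, t0 <= t -> c0 <= L t].
Hypothesis A2 : exists2 M : R, 0 < M & forall t : R, 0 < t -> L t <= M.
Variables c1 c2 : R.
Hypothesis c2_ge1 : 1 <= c2.

(** Every data vector gives [1 / n <= tau_hat <= 1], so [A] can be chosen uniformly in [n] and
    [x]. *)
Lemma eb_rule_detects (delta : R) : 0 < delta ->
  exists A : R, forall (n : nat) (x : 'rV[R]_n) i, (0 < n)%N ->
    A <= Num.sqrt (2 * ln n%:R) -> Num.sqrt (2 * ln n%:R) + delta < `|x 0 i| ->
    eb_rule (1 / 2) L c1 c2 x i.
Proof.
move=> d0; have [c0 [t0 [c00 t00 L_ge]]] := A1; have [M M0 L_le] := A2.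
have [C C0 HC] := shrinkage_gt_half_upper prior c00 t00 L_ge M0 L_le.
have [A HA] := detection_threshold C0 d0.
exists A => n x i n0 hA hx.
have [h1 h2 h3] := HA n _ n0 hA hx.
have xx : x 0 i ^+ 2 = `|x 0 i| ^+ 2 by rewrite real_normK ?num_real.
apply: HC => //; rewrite ?xx ?tau_hat_gt0 ?tau_hat_le1//.
exact: lt_le_trans h2 (tau_hat_ge _ _ _).
Qed.

(** The count bound gives [tau_hat <= 2 * q / n]; taking logarithms in
    [c < tau_hat * expR (x ^+ 2 / 2)] yields the fixed shift [k = 2 * ln (c / 2)]. *)
Lemma eb_rule_selected_gt : exists k : R, forall (n q : nat) (x : 'rV[R]_n) i,
  (0 < n)%N -> (0 < q)%N ->
  \sum_(j < n) (Num.sqrt (c1 * ln n%:R) < `|x 0 j|)%R%:R <= 2 * q%:R :> R ->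
  0 <= 2 * ln (n%:R / q%:R) + k ->
  eb_rule (1 / 2) L c1 c2 x i -> Num.sqrt (2 * ln (n%:R / q%:R) + k) < `|x 0 i|.
Proof.
have [c0 [t0 [c00 t00 L_ge]]] := A1; have [M M0 L_le] := A2.
have [c c_gt0 Hc] := shrinkage_gt_half_lower prior c00 t00 L_ge M0 L_le.
exists (2 * ln (c / 2)) => n q x i n0 q0 hN hk hsel.
have nr : 0 < n%:R :> R by rewrite ltr0n.
have qr : 1 <= q%:R :> R by rewrite ler1n.
have qr0 : 0 < q%:R :> R by rewrite ltr0n.
have h := Hc _ _ (tau_hat_gt0 _ _ n0 x) (tau_hat_le1 _ c2_ge1 n0 x) hsel.
have ht : tau_hat c1 c2 x <= 2 * q%:R / n%:R by apply: tau_hat_le => //; lra.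
have {}h : c < 2 * q%:R / n%:R * expR (x 0 i ^+ 2 / 2).
  by apply: lt_le_trans h _; rewrite ler_pM2r ?expR_gt0.
have : n%:R / q%:R * (c / 2) < expR (x 0 i ^+ 2 / 2).
  rewrite -(ltr_pM2l (divr_gt0 (mulr_gt0 (ltr0n R 2) qr0) nr)).
  apply: le_lt_trans h; rewrite le_eqVlt; apply/orP; left; apply/eqP.
  by field; rewrite !gt_eqF.
rewrite -ltr_ln ?posrE ?expR_gt0 ?mulr_gt0 ?divr_gt0 ?invr_gt0// expRK.
have -> : ln (n%:R / q%:R * (c / 2)) = ln (n%:R / q%:R) + ln (c / 2).
  by apply: lnM; rewrite posrE divr_gt0.
move=> {}h; have hx : 2 * ln (n%:R / q%:R) + 2 * ln (c / 2) < x 0 i ^+ 2 by lra.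
by rewrite -sqrtr_sqr ltr_sqrt//; exact: le_lt_trans hk hx.
Qed.

End eb_rule_thresholds.

(** * Boundary mean vectors *)

Section sparse_means.
Context {R : realType}.
Implicit Types m : R.

Lemma card_lt_ord (n q : nat) : (q <= n)%N -> #|[set i : 'I_n | (i < q)%N]%SET| = q.
Proof.
move=> qn; rewrite -sum1_card.
under eq_bigl do rewrite inE.
by rewrite -(big_ord_widen _ (fun=> 1%N) qn) sum1_card card_ord.
Qed.

Lemma least_favorable_mean (n q : nat) m : (q <= n)%N -> 0 < m ->
  exists2 theta : 'rV[R]_n, #|supp theta| = q &
    forall i, i \in supp theta -> theta 0 i = - m.
Proof.
move=> qn m0; exists (\row_(i < n) if (i < q)%N then - m else 0).
  rewrite -[RHS](card_lt_ord qn); apply: eq_card => i.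
  by rewrite !inE mxE; case: ifP; rewrite ?eqxx// oppr_eq0 gt_eqF.
by move=> i; rewrite inE mxE; case: ifP; rewrite ?eqxx.
Qed.

End sparse_means.

(** If [x - y > e], then [x ^+ 2 - y ^+ 2 >= (x - y) * x > e * x]. *)
Lemma sub_le_of_sqr {R : realFieldType} (e x y : R) : 0 <= e -> 0 <= y -> 0 < x ->
  x ^+ 2 - y ^+ 2 <= e * x -> x - y <= e.
Proof.
move=> e0 y0 x0 h; rewrite leNgt; apply/negP => exy.
have : e * x < (x - y) * x by rewrite ltr_pM2r.
have : y * y <= y * x by rewrite ler_wpM2l//; lra.
lra.
Qed.

(** * Polylogarithmic sparsity *)

Section sparse_asymptotics.
Context {R : realType}.
Variable q : nat -> nat.
Hypothesis q_gt0 : forall n : nat, (0 < q n)%N.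
Hypothesis q_sparse : (q n)%:R / n%:R @[n --> \oo] --> (0 : R).
Variable delta2 : R.
Hypothesis delta2_gt1 : 1 < delta2.
Hypothesis q_polylog : asymp_equiv (fun n : nat => (q n)%:R : R)
                                   (fun n : nat => ln n%:R `^ delta2).

Let v n : R := ln (n%:R / (q n)%:R).

Lemma near_ln_sparsity_ge (A : R) : \forall n \near \oo, A <= v n.
Proof.
have /cvgr0Pnorm_lt h := q_sparse.
near=> n.
have n0 : (0 < n)%N by near: n; exact: nbhs_infty_gt.
have nr : 0 < n%:R :> R by rewrite ltr0n.
have qr : 0 < (q n)%:R :> R by rewrite ltr0n.
rewrite -ler_expR /v lnK ?posrE ?divr_gt0//.
have : `|(q n)%:R / n%:R| < expR (- A) :> R by near: n; apply: h; exact: expR_gt0.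
rewrite ger0_norm ?divr_ge0 ?ler0n// ltr_pdivrMr// expRN mulrC ltr_pdivlMr ?expR_gt0// => hq.
by rewrite ler_pdivlMr// mulrC ltW.
Unshelve. all: by end_near. Qed.

Lemma near_sparsity_le : \forall n \near \oo, (0 < n)%N /\ (q n <= n)%N.
Proof.
near=> n.
have n0 : (0 < n)%N by near: n; exact: nbhs_infty_gt.
split => //; rewrite leqNgt; apply/negP => nq.
have : 1 <= v n by near: n; exact: near_ln_sparsity_ge.
apply/negP; rewrite -ltNge; apply: (@le_lt_trans _ _ 0) => //.
by apply: ln_le0; rewrite ler_pdivrMr ?ltr0n// mul1r ler_nat ltnW.
Unshelve. all: by end_near. Qed.

Lemma ln_sparsityE n : (0 < n)%N -> v n = ln n%:R - ln (q n)%:R.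
Proof. by move=> n0; rewrite /v ln_div// posrE ltr0n. Qed.

Lemma ln_sparsity_le n : (0 < n)%N -> v n <= ln n%:R.
Proof.
by move=> n0; rewrite ln_sparsityE// gerBl ln_ge0// ler1n.
Qed.

Lemma near_ln_ge (A : R) : \forall n \near \oo, A <= ln (n%:R : R).
Proof.
near=> n; have n0 : (0 < n)%N by near: n; exact: nbhs_infty_gt.
apply: le_trans (ln_sparsity_le n0); near: n; exact: near_ln_sparsity_ge.
Unshelve. all: by end_near. Qed.

(** Once [ln n >= 1], the exponent [delta2 > 1] gives [q n >= c * ln n], which diverges. *)
Lemma near_sparsity_ge (A : R) : \forall n \near \oo, A <= (q n)%:R.
Proof.
have [c [c' [c0 h]]] := q_polylog.
near=> n.
have /andP[hn _] : c <= (q n)%:R / (ln n%:R `^ delta2) <= c' by near: n; exact: h.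
have l1 : 1 <= ln (n%:R : R) by near: n; exact: near_ln_ge.
have lA : A / c <= ln (n%:R : R) by near: n; exact: near_ln_ge.
have l0 : 0 < ln (n%:R : R) `^ delta2 by rewrite powR_gt0// (lt_le_trans _ l1).
rewrite ler_pdivlMr// in hn; apply: le_trans hn.
rewrite mulrC -ler_pdivrMr//; apply: (le_trans lA).
by rewrite le1r_powR// ltW.
Unshelve. all: by end_near. Qed.

(** The squares differ by [2 * ln (q n)], which is of order [ln (ln n)] and hence negligible against
    [Num.sqrt (ln n)]. Writing [ln n = z ^+ 4] makes this elementary through [ln z <= z]. *)
Lemma near_sqrt_ln_gap (e : R) : 0 < e ->
  \forall n \near \oo, Num.sqrt (2 * ln n%:R) - Num.sqrt (2 * v n) <= e.
Proof.
move=> e0; have [c [c' [c0 h]]] := q_polylog.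
(* For [z >= 1], [K * z] bounds [2 * ln (q n)]; the threshold [Z] ensures [K <= e * z]. *)
pose K := 2 * `|ln c'| + 8 * delta2.
have K0 : 0 < K by rewrite ltr_wpDl ?mulr_ge0// mulr_gt0// (lt_trans ltr01).
pose Z := 1 + K / e.
have Z1 : 1 <= Z by rewrite lerDl divr_ge0 ?ltW.
near=> n; have n0 : (0 < n)%N by near: n; exact: nbhs_infty_gt.
have /andP[hn1 hn2] : c <= (q n)%:R / (ln n%:R `^ delta2) <= c' by near: n; exact: h.
have lZ : Z ^+ 4 <= ln (n%:R : R) by near: n; exact: near_ln_ge.
have v0 : 0 <= v n by near: n; exact: near_ln_sparsity_ge.
set X := ln (n%:R : R) in hn1 hn2 lZ *.
have X0 : 0 < X by apply: lt_le_trans lZ; rewrite exprn_gt0// (lt_le_trans ltr01).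
pose z := Num.sqrt (Num.sqrt X).
have z4 : z ^+ 4 = X by rewrite (exprM _ 2 2) !sqr_sqrtr ?sqrtr_ge0 ?ltW.
have z0 : 0 < z by rewrite !sqrtr_gt0.
have Zz : Z <= z.
  by rewrite -(@ler_pXn2r _ 4) ?nnegrE ?(ltW z0) ?(le_trans ler01 Z1)// z4.
have qr : 0 < (q n)%:R :> R by rewrite ltr0n.
have c'0 : 0 < c' by apply: lt_le_trans (le_trans hn1 hn2).
have lnX : ln X <= 4 * z.
  rewrite -z4 lnXn// -[leLHS]mulr_natl ler_pM2l//; exact/ltW/ln_sublinear.
have lnq : ln (q n)%:R <= `|ln c'| + delta2 * (4 * z).
  apply: (@le_trans _ _ (ln c' + delta2 * ln X)).
    rewrite -ln_powR -lnM ?posrE ?powR_gt0//.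
    rewrite ler_ln ?posrE ?mulr_gt0 ?powR_gt0//.
    by rewrite -ler_pdivrMr ?powR_gt0.
  rewrite lerD ?ler_norm// ler_pM2l//; exact: lt_trans delta2_gt1.
have a0 : 0 <= Num.sqrt (2 * v n) by exact: sqrtr_ge0.
have S2 : Num.sqrt (2 * X) ^+ 2 = 2 * X by rewrite sqr_sqrtr// mulr_ge0// ltW.
have s2 : Num.sqrt (2 * v n) ^+ 2 = 2 * v n by rewrite sqr_sqrtr// mulr_ge0.
have Sz : z ^+ 2 <= Num.sqrt (2 * X).
  rewrite -(@ler_pXn2r _ 2) ?nnegrE ?sqr_ge0 ?sqrtr_ge0// S2 -exprM z4; lra.
have vE : v n = X - ln (q n)%:R by exact: ln_sparsityE.
have z1 : 1 <= z by exact: le_trans Zz.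
have Kz : K <= e * z.
  have : e * Z <= e * z by rewrite ler_pM2l.
  rewrite /Z mulrDr mulr1 mulrCA divff ?gt_eqF// mulr1; lra.
have hlq : 2 * ln (q n)%:R <= e * z ^+ 2.
  apply: (@le_trans _ _ (K * z)).
    apply: (@le_trans _ _ (2 * (`|ln c'| + delta2 * (4 * z)))); first by rewrite ler_pM2l.
    have := ler_peMr (normr_ge0 (ln c')) z1; rewrite /K; lra.
  by rewrite expr2 mulrA ler_pM2r.
have S0 : 0 < Num.sqrt (2 * X) by apply: lt_le_trans Sz; rewrite exprn_gt0.
apply: sub_le_of_sqr; rewrite ?(ltW e0)// S2 s2 vE.
have : e * z ^+ 2 <= e * Num.sqrt (2 * X) by rewrite ler_pM2l.
lra.
Unshelve. all: by end_near. Qed.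

(** A bounded shift under a diverging square root moves it by o(1): once [s = Num.sqrt (2 * v n)]
    satisfies [e * s >= e ^+ 2 + |k|], the square of [s - e] is at most [s ^+ 2 + k]. *)
Lemma near_sqrt_shift (k e : R) : 0 < e ->
  \forall n \near \oo, Num.sqrt (2 * v n) - e <= Num.sqrt (2 * v n + k).
Proof.
move=> e0; near=> n.
have h1 : (e + `|k| / e) ^+ 2 <= v n by near: n; exact: near_ln_sparsity_ge.
have kk : - `|k| <= k by rewrite lerNl -normrN ler_norm.
have b0 : 0 <= e + `|k| / e by rewrite addr_ge0 ?divr_ge0 ?normr_ge0 ?(ltW e0).
have v0 : 0 <= v n by apply: le_trans h1; exact: sqr_ge0.
have s2 : Num.sqrt (2 * v n) ^+ 2 = 2 * v n by rewrite sqr_sqrtr// mulr_ge0.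
have hs : e + `|k| / e <= Num.sqrt (2 * v n).
  by rewrite -(@ler_pXn2r _ 2) ?nnegrE ?sqrtr_ge0// s2; lra.
set s := Num.sqrt (2 * v n) in s2 hs *.
have es : e * s >= e ^+ 2 + `|k|.
  have : e * (e + `|k| / e) <= e * s by rewrite ler_pM2l.
  by rewrite mulrDr mulrCA divff ?gt_eqF// mulr1 expr2.
have se : 0 <= s - e by have := divr_ge0 (normr_ge0 k) (ltW e0); lra.
rewrite -[leLHS]ger0_norm// -sqrtr_sqr ler_wsqrtr//.
have -> : (s - e) ^+ 2 = s ^+ 2 - 2 * (e * s) + e ^+ 2 by ring.
by rewrite s2; have := sqr_ge0 e; have := normr_ge0 k; lra.
Unshelve. all: by end_near. Qed.

Lemma near_sqrt_shift_ge (k A : R) :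
  \forall n \near \oo, [/\ 0 <= 2 * v n + k & A <= Num.sqrt (2 * v n + k)].
Proof.
near=> n.
have h1 : A ^+ 2 + `|k| <= v n by near: n; exact: near_ln_sparsity_ge.
have kk : - `|k| <= k by rewrite lerNl -normrN ler_norm.
have := sqr_ge0 A => A20; have h : A ^+ 2 <= 2 * v n + k by have := normr_ge0 k; lra.
split; first exact: le_trans h.
by apply: le_trans (ler_norm A) _; rewrite -sqrtr_sqr ler_wsqrtr.
Unshelve. all: by end_near. Qed.

End sparse_asymptotics.

(** * Expected null exceedances and the error budget *)

Section gaussian_tails.
Context {R : realType}.
Local Notation Phi := (@std_normal_cdf R).

Lemma std_normal_tail_le_inv (t : R) : 0 < t -> Phi (- t) <= t^-1.
Proof.
move=> t0; apply: le_trans (std_normal_tail t0) _.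
rewrite ler_piMl ?invr_ge0 ?(ltW t0)//.
by rewrite -[leRHS]expR0 ler_expR mulNr oppr_le0 divr_ge0// sqr_ge0.
Qed.

(** With [c >= 2], Mills' bound at this threshold is at most [1 / n], so about one null per side is
    expected beyond it. *)
Lemma count_tail_le (n q : nat) (c : R) : (0 < n)%N -> (0 < q)%N -> 2 <= c ->
  1 <= ln (n%:R : R) ->
  n%:R / q%:R * Phi (- Num.sqrt (c * ln n%:R)) <= q%:R^-1.
Proof.
move=> n0 q0 c2 l1.
have nr : 0 < n%:R :> R by rewrite ltr0n.
have qr : 0 < q%:R :> R by rewrite ltr0n.
have cl : 2 * ln n%:R <= c * ln (n%:R : R) by rewrite ler_wpM2r// (le_trans ler01).
have t1 : 1 <= Num.sqrt (c * ln (n%:R : R)).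
  by rewrite -[leLHS]sqrtr1 ler_wsqrtr//; lra.
have h : Phi (- Num.sqrt (c * ln n%:R)) <= n%:R^-1.
  apply: le_trans (std_normal_tail (lt_le_trans ltr01 t1)) _.
  rewrite sqr_sqrtr; last lra.
  rewrite ler_pdivrMr ?(lt_le_trans ltr01 t1)//.
  apply: (@le_trans _ _ n%:R^-1); last by rewrite ler_peMr ?invr_ge0 ?(ltW nr).
  rewrite -[X in _ <= X^-1](lnK (_ : n%:R \is Num.pos)) ?posrE// -expRN ler_expR; lra.
rewrite mulrAC ler_pdivrMr// mulVf ?gt_eqF//.
by apply: le_trans (ler_wpM2l (ltW nr) h) _; rewrite mulfV ?gt_eqF.
Qed.

(** The exponential in Mills' bound equals [q / n] up to [expR (- (k / 2))] and cancels the
    prefactor; only the vanishing Mills factor is left. *)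
Lemma sparse_tail_le (n q : nat) (k : R) : (0 < n)%N -> (0 < q)%N ->
  0 <= 2 * ln (n%:R / q%:R) + k ->
  0 < Num.sqrt (2 * ln (n%:R / q%:R) + k) ->
  n%:R / q%:R * Phi (- Num.sqrt (2 * ln (n%:R / q%:R) + k)) <=
  expR (- (k / 2)) / Num.sqrt (2 * ln (n%:R / q%:R) + k).
Proof.
move=> n0 q0 vk l0.
have nr : 0 < n%:R :> R by rewrite ltr0n.
have qr : 0 < q%:R :> R by rewrite ltr0n.
have r0 : 0 < n%:R / q%:R :> R by rewrite divr_gt0.
have h := std_normal_tail l0.
apply: le_trans (ler_wpM2l (ltW r0) h) _.
rewrite mulrA ler_pM2r ?invr_gt0// sqr_sqrtr//.
rewrite -[X in X * _ <= _](lnK (_ : n%:R / q%:R \is Num.pos)) ?posrE//.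
rewrite -expRD ler_expR; lra.
Qed.

End gaussian_tails.

(** Each of the three FDR terms costs at most [e / 5], as does the loss [2 * w] in the detection
    probability. Here [r] stands for [n / q], [ft] and [fl] for the tails at the counting and
    selection thresholds, and [pb] for [Phi b]. *)
Lemma risk_budget {R : realFieldType} (e w p0 p pb Q r ft fl E l : R) :
  0 < e -> w <= e / 10 -> 0 < p0 -> p0 <= p -> pb - 2 * w <= p -> 0 < Q -> 0 < l ->
  10 / e <= Q -> 20 / (e * p0 ^+ 2) <= Q -> 20 * E / (e * p0) <= l ->
  r * ft <= Q^-1 -> r * fl <= E / l ->
  2 * r * ft + 4 / (p ^+ 2 * Q) + 4 * r * fl / p + (1 - p) <= 1 - pb + e.
Proof.
move=> e0 we p00 p0p pp Q0 l0 hq1 hq2 lk tail1 tail2.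
have p_gt0 : 0 < p by exact: lt_le_trans p0p.
have b1 : Q^-1 <= e / 10.
  by rewrite -[leRHS]invrK lef_pV2 ?posrE ?invr_gt0 ?divr_gt0// invf_div.
have b2 : 4 / (p ^+ 2 * Q) <= e / 5.
  rewrite ler_pdivrMr ?mulr_gt0 ?exprn_gt0//.
  have h : 20 <= Q * (e * p0 ^+ 2) by rewrite -ler_pdivrMr// mulr_gt0 ?exprn_gt0.
  have h2 : p0 ^+ 2 <= p ^+ 2 by rewrite ler_pXn2r ?nnegrE ?(ltW p00) ?(ltW p_gt0).
  have := ler_wpM2l (ltW (mulr_gt0 Q0 e0)) h2; lra.
have b3 : 4 * r * fl / p <= e / 5.
  rewrite ler_pdivrMr//.
  have h : E / l <= e * p0 / 20.
    rewrite ler_pdivrMr//; move: lk; rewrite ler_pdivrMr ?mulr_gt0//; lra.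
  have := ler_wpM2l (ltW e0) p0p; lra.
lra.
Qed.

(** * Limits of the maximal risk *)

Section sup_risk_limits.
Variables (R : realType) (d : nat -> measure_display).
Variable T : forall n : nat, measurableType (d n).
Variable P : forall n : nat, probability (T n) R.
Variable eps : forall n : nat, 'I_n -> {RV (P n) >-> R}.
Arguments eps : clear implicits.
Hypothesis eps_normal : forall (n : nat) (i : 'I_n), has_std_normal_law (eps n i).
Hypothesis eps_indep : forall n : nat, mutually_independent (eps n).
Variable q : nat -> nat.
Hypothesis q_gt0 : forall n : nat, (0 < q n)%N.
Hypothesis q_sparse : (q n)%:R / n%:R @[n --> \oo] --> (0 : R).
Variable delta2 : R.
Hypothesis delta2_gt1 : 1 < delta2.
Hypothesis q_polylog : asymp_equiv (fun n : nat => (q n)%:R : R)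
                                   (fun n : nat => ln n%:R `^ delta2).
Variable L : R -> R.
Hypothesis prior : one_group_prior (1 / 2) L.
Hypothesis A1 : exists c0 t0 : R, [/\ 0 < c0, 0 < t0 & forall t : R, t0 <= t -> c0 <= L t].
Hypothesis A2 : exists2 M : R, 0 < M & forall t : R, 0 < t -> L t <= M.
Variables c1 c2 : R.
Hypothesis c1_ge2 : 2 <= c1.
Hypothesis c2_ge1 : 1 <= c2.
Local Notation Phi := (@std_normal_cdf R).
Local Notation SR n b :=
  (sup_risk (eps n) (eb_rule (1 / 2) L c1 c2 (n := n)) (beta_min_class (q n) b)).

(** Signals are at least [s + b] and are detected beyond [S + w]. Since [S - s <= w], the detection
    probability is at least [Phi (b - 2 * w)], uniformly over the class. *)
Lemma near_sup_risk_le (b e : R) : 0 < e ->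
  \forall n \near \oo, (SR n b <= (1 - Phi b + e)%:E)%E.
Proof.
move=> e0; pose w := Num.min (1 / 2) (e / 10).
have w0 : 0 < w by rewrite lt_min !divr_gt0.
have w1 : w <= 1 / 2 by rewrite ge_min lexx.
have we : w <= e / 10 by rewrite ge_min lexx orbT.
have [A HA] := eb_rule_detects prior A1 A2 c1 c2_ge1 w0.
have [k Hk] := eb_rule_selected_gt prior A1 A2 c1 c2_ge1.
(* Since [w <= 1 / 2], the argument [s + b - (S + w)] stays above [b - 1], so [p0] bounds the
   detection probability below independently of [n]. *)
pose p0 := Phi (b - 1); have p00 : 0 < p0 by exact: std_normal_cdf_gt0.
pose E := expR (- (k / 2)) : R; have E0 : 0 < E by exact: expR_gt0.
near=> n.
have [n0 qn] : (0 < n)%N /\ (q n <= n)%N by near: n; exact: near_sparsity_le q_gt0 q_sparse.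
have l1 : 1 <= ln (n%:R : R) by near: n; exact: (near_ln_ge q_gt0 q_sparse).
have lA : A ^+ 2 <= ln (n%:R : R) by near: n; exact: (near_ln_ge q_gt0 q_sparse).
have gap : Num.sqrt (2 * ln n%:R) - Num.sqrt (2 * ln (n%:R / (q n)%:R)) <= w.
  by near: n; exact: (near_sqrt_ln_gap q_gt0 q_sparse delta2_gt1 q_polylog).
have [vk lk] : 0 <= 2 * ln (n%:R / (q n)%:R) + k /\
    1 + 20 * E / (e * p0) <= Num.sqrt (2 * ln (n%:R / (q n)%:R) + k).
  by near: n; exact: (near_sqrt_shift_ge q_gt0 q_sparse k).
have hq1 : 10 / e <= (q n)%:R by near: n;
    exact: (near_sparsity_ge q_gt0 q_sparse delta2_gt1 q_polylog).
have hq2 : 20 / (e * p0 ^+ 2) <= (q n)%:R by near: n;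
    exact: (near_sparsity_ge q_gt0 q_sparse delta2_gt1 q_polylog).
have AS : A <= Num.sqrt (2 * ln n%:R).
  apply: le_trans (ler_norm A) _; rewrite -sqrtr_sqr ler_wsqrtr//; lra.
have qr : 0 < (q n)%:R :> R by rewrite ltr0n.
have tail1 := count_tail_le n0 (q_gt0 n) c1_ge2 l1.
set S := Num.sqrt (2 * ln n%:R) in gap AS.
set s := Num.sqrt (2 * ln (n%:R / (q n)%:R)) in gap.
have l0 : 0 < Num.sqrt (2 * ln (n%:R / (q n)%:R) + k).
  by apply: lt_le_trans lk; rewrite ltr_pwDl// divr_ge0// ?mulr_ge0// ltW.
have tail2 := sparse_tail_le n0 (q_gt0 n) vk l0.
have pp : Phi b - 2 * w <= Phi (s + b - (S + w)).
  have sS : s <= S by rewrite ler_wsqrtr// ler_pM2l//; exact: (ln_sparsity_le q_gt0).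
  have h : s + b - (S + w) <= b by lra.
  have := std_normal_cdf_lipschitz h; lra.
have p0p : p0 <= Phi (s + b - (S + w)) by rewrite le_std_normal_cdf//; lra.
apply: ge_ereal_sup => _ [theta [card_theta theta_ge] <-].
have qs : (0 < #|supp theta|)%N by rewrite card_theta.
have det (x : 'rV[R]_n) i : S + w < `|x 0 i| -> eb_rule (1 / 2) L c1 c2 x i by exact: HA.
have rej (x : 'rV[R]_n) i : \sum_(j < n) (Num.sqrt (c1 * ln n%:R) < `|x 0 j|)%R%:R <= 2 *
    #|supp theta|%:R :> R ->
    eb_rule (1 / 2) L c1 c2 x i -> Num.sqrt (2 * ln (n%:R / (q n)%:R) + k) < `|x 0 i|.
  by rewrite card_theta => hN; exact: Hk.
have hFNR := FNR_le (@eps_normal n) qs theta_ge det.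
have hFDR := FDR_le (@eps_normal n) (@eps_indep n) qs theta_ge det rej.
apply: le_trans (leeD hFDR hFNR) _; rewrite -EFinD lee_fin card_theta.
move: tail1 tail2 pp p0p l0 lk.
set p := Phi (s + b - (S + w)); set l := Num.sqrt (_ + k) => tail1 tail2 pp p0p l0 lk.
have {}lk : 20 * E / (e * p0) <= l by rewrite (le_trans _ lk)// lerDr.
exact: (risk_budget e0 we p00 p0p pp qr l0 hq1 hq2 lk tail1 tail2).
Unshelve. all: by end_near. Qed.

Lemma near_sup_risk_attained (b : nat -> R) :
  (\forall n \near \oo, 0 < Num.sqrt (2 * ln (n%:R / (q n)%:R)) + b n) ->
  \forall n \near \oo, exists2 theta : 'rV[R]_n,
    #|supp theta| = q n /\
      (forall i, i \in supp theta ->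
          theta 0 i = - (Num.sqrt (2 * ln (n%:R / (q n)%:R)) + b n)) &
    (risk (eps n) theta (eb_rule (1 / 2) L c1 c2 (n := n)) <= SR n (b n))%E.
Proof.
move=> hb; near=> n.
have [n0 qn] : (0 < n)%N /\ (q n <= n)%N by near: n; exact: near_sparsity_le q_gt0 q_sparse.
have m0 : 0 < Num.sqrt (2 * ln (n%:R / (q n)%:R)) + b n by near: n.
have [theta ct ht] := least_favorable_mean qn m0.
exists theta => //; apply: ereal_sup_ubound; exists theta => //; split => // i /ht ->.
by rewrite normrN ger0_norm// ltW.
Unshelve. all: by end_near. Qed.

(** Evaluate the risk at a boundary vector and drop its FDR. The threshold drift, the wrong-side
    exceedance and the null count each cost at most [e / 4] in [FNR_ge]. *)
Lemma near_sup_risk_ge (b e : R) : 0 < e ->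
  \forall n \near \oo, ((1 - Phi b - e)%:E <= SR n b)%E.
Proof.
move=> e0.
have [k Hk] := eb_rule_selected_gt prior A1 A2 c1 c2_ge1.
have hm : \forall n \near \oo, 0 < Num.sqrt (2 * ln (n%:R / (q n)%:R)) + b.
  apply: filterS (near_sqrt_shift_ge q_gt0 q_sparse 0 (1 - b)) => n [_].
  rewrite addr0; lra.
near=> n.
have [n0 qn] : (0 < n)%N /\ (q n <= n)%N by near: n; exact: near_sparsity_le q_gt0 q_sparse.
have m0 : 0 < Num.sqrt (2 * ln (n%:R / (q n)%:R)) + b by near: n; exact: hm.
have l1 : 1 <= ln (n%:R : R) by near: n; exact: (near_ln_ge q_gt0 q_sparse).
have sl : Num.sqrt (2 * ln (n%:R / (q n)%:R)) - e / 4 <= Num.sqrt (2 * ln (n%:R / (q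
    n)%:R) + k).
  by near: n; apply: (near_sqrt_shift q_gt0 q_sparse); rewrite divr_gt0.
have [vk lk] : 0 <= 2 * ln (n%:R / (q n)%:R) + k /\
    4 / e <= Num.sqrt (2 * ln (n%:R / (q n)%:R) + k).
  by near: n; exact: (near_sqrt_shift_ge q_gt0 q_sparse k).
have hq1 : 8 / e <= (q n)%:R by near: n;
    exact: (near_sparsity_ge q_gt0 q_sparse delta2_gt1 q_polylog).
have [theta [card_theta theta_eq]] : exists2 theta : 'rV[R]_n,
    #|supp theta| = q n /\
      (forall i, i \in supp theta -> theta 0 i = - (Num.sqrt (2 * ln (n%:R / (q n)%:R)) + b)) &
    (risk (eps n) theta (eb_rule (1 / 2) L c1 c2 (n := n)) <= SR n b)%E.
  by near: n; exact: (near_sup_risk_attained (b := fun=> b) hm).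
apply: le_trans.
have qs : (0 < #|supp theta|)%N by rewrite card_theta.
have rej (x : 'rV[R]_n) i : \sum_(j < n) (Num.sqrt (c1 * ln n%:R) < `|x 0 j|)%R%:R <= 2 *
    #|supp theta|%:R :> R ->
    eb_rule (1 / 2) L c1 c2 x i -> Num.sqrt (2 * ln (n%:R / (q n)%:R) + k) < `|x 0 i|.
  by rewrite card_theta => hN; exact: Hk.
have hFNR := FNR_ge (@eps_normal n) qs theta_eq rej.
apply: (@le_trans _ _ (FNR (eps n) theta (eb_rule (1 / 2) L c1 c2 (n := n)))); last first.
  by rewrite leeDr// expectation_ge0// => y; rewrite divr_ge0 ?sumr_ge0// le_max ler01 orbT.
apply: le_trans hFNR; rewrite lee_fin card_theta.
have tail1 := count_tail_le n0 (q_gt0 n) c1_ge2 l1.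
have qr : 0 < (q n)%:R :> R by rewrite ltr0n.
have b1 : (q n)%:R^-1 <= e / 8.
  by rewrite -[leRHS]invrK lef_pV2 ?posrE ?invr_gt0 ?divr_gt0// invf_div.
move: sl lk m0; set s := Num.sqrt _; set l := Num.sqrt (_ + k) => sl lk m0.
have l0 : 0 < l by apply: lt_le_trans lk; rewrite divr_gt0.
have h1 : Phi (- (s + b) - l) <= e / 4.
  apply: (@le_trans _ _ (Phi (- l))); first by rewrite le_std_normal_cdf//; lra.
  apply: le_trans (std_normal_tail_le_inv l0) _.
  by rewrite -[leRHS]invrK lef_pV2 ?posrE ?invr_gt0 ?divr_gt0// invf_div.
have h2 : Phi (s + b - l) <= Phi b + e / 4.
  apply: (@le_trans _ _ (Phi (b + e / 4))); first by rewrite le_std_normal_cdf//; lra.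
  have h : b <= b + e / 4 by lra.
  by have := std_normal_cdf_lipschitz h; lra.
lra.
Unshelve. all: by end_near. Qed.

(** A supremum over an empty class would be [-oo], so a member of the class is exhibited. *)
Lemma near_sup_risk_ge0 (b : nat -> R) : b n @[n --> \oo] --> +oo ->
  \forall n \near \oo, (0 <= SR n (b n))%E.
Proof.
move=> /cvgryPge hb.
have hm : \forall n \near \oo, 0 < Num.sqrt (2 * ln (n%:R / (q n)%:R)) + b n.
  near=> n; have b1 : 1 <= b n by near: n; exact: hb.
  by rewrite ltr_wpDl ?sqrtr_ge0// (lt_le_trans ltr01).
apply: filterS (near_sup_risk_attained hm) => n [theta _]; apply: le_trans.
rewrite adde_ge0// expectation_ge0// => y;
    rewrite divr_ge0 ?le_max ?ler01 ?orbT// sumr_ge0// => i _.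
by case: (eb_rule _ _ _ _ _ _); rewrite ?subrr ?subr0.
Unshelve. all: by end_near. Qed.

Lemma sup_risk_antitone n (b b' : R) : b <= b' -> (SR n b' <= SR n b)%E.
Proof.
move=> bb; apply: ereal_sup_le => _ [theta [ct ht] <-]; exists theta => //.
by split => // i /ht; apply: le_trans; rewrite lerD2l.
Qed.

End sup_risk_limits.

(** * Assembly of the two limits *)

Lemma cvge_of_near_between {R : realType} (f : nat -> \bar R) (l : nat -> R) :
  (forall e : R, 0 < e -> \forall n \near \oo, ((l n - e)%:E <= f n <= (l n + e)%:E)%E) ->
  (f n - (l n)%:E)%E @[n --> \oo] --> (0%R : R)%:E.
Proof.
move=> h; apply/fine_cvgP; split.
  (* The bracket of width 1 already excludes infinite values, so convergence can be read off the
     real parts. *)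
  apply: filterS (h 1 ltr01) => n /andP[h1 h2].
  rewrite fin_numB andbT fin_numE; apply/andP; split; apply/eqP => fE.
    by move: h1; rewrite fE leeNy_eq.
  by move: h2; rewrite fE leye_eq.
apply/cvgrPdist_le => e e0; apply: filterS (h e e0) => n /=.
case: (f n) => [r| |]; rewrite ?leeNy_eq ?leye_eq ?andbF//= !lee_fin => /andP[h1 h2].
rewrite sub0r normrN ler_norml; apply/andP; split; lra.
Qed.

Theorem theorem5 (R : realType)
    (d : nat -> measure_display) (T : forall n : nat, measurableType (d n))
    (P : forall n : nat, probability (T n) R)
    (eps : forall n : nat, 'I_n -> {RV (P n) >-> R})
    (eps_normal : forall (n : nat) (i : 'I_n), has_std_normal_law (eps n i))
    (eps_indep : forall n : nat, mutually_independent (eps n))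
    (q : nat -> nat)
    (q_gt0 : forall n : nat, (0 < q n)%N)
    (q_sparse : (q n)%:R / n%:R @[n --> \oo] --> (0 : R))
    (delta2 : R) (delta2_gt1 : 1 < delta2)
    (q_polylog : asymp_equiv (fun n : nat => (q n)%:R : R)
                             (fun n : nat => ln n%:R `^ delta2))
    (L : R -> R)
    (prior : one_group_prior (1 / 2) L)
    (A1 : exists c0 t0 : R, [/\ 0 < c0, 0 < t0 &
            forall t : R, t0 <= t -> c0 <= L t])
    (A2 : exists2 M : R, 0 < M & forall t : R, 0 < t -> L t <= M)
    (c1 c2 : R) (c1_ge2 : 2 <= c1) (c2_ge1 : 1 <= c2) :
  (forall b : R,
     (sup_risk (eps n) (eb_rule (1 / 2) L c1 c2 (n := n))
        (beta_min_class (q n) b) - (1 - std_normal_cdf b)%:E)%E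
       @[n --> \oo] --> (0%R : R)%:E) /\
  (forall b : nat -> R, b n @[n --> \oo] --> +oo ->
     (sup_risk (eps n) (eb_rule (1 / 2) L c1 c2 (n := n))
        (beta_min_class (q n) (b n)) - (1 - std_normal_cdf (b n))%:E)%E
       @[n --> \oo] --> (0%R : R)%:E).
Proof.
have ub := near_sup_risk_le eps_normal eps_indep q_gt0 q_sparse delta2_gt1 q_polylog
  prior A1 A2 c1_ge2 c2_ge1.
split=> [b|b b_oo].
  apply: (@cvge_of_near_between _ _ (fun=> 1 - std_normal_cdf b)) => e e0.
  have lb := near_sup_risk_ge eps_normal q_gt0 q_sparse delta2_gt1 q_polylog
    prior A1 A2 c1_ge2 c2_ge1 b e0.
  by apply: filterS2 lb (ub b e e0) => n -> ->.
apply: (@cvge_of_near_between _ _ (fun n => 1 - std_normal_cdf (b n))) => e e0.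
have sr_ge0 := near_sup_risk_ge0 eps q_gt0 q_sparse L c1 c2 b_oo.
(* The fixed level [2 / e] comes from [Phi (- t) <= 1 / t], which makes its limiting risk at most
   [e / 2]. *)
have B0 : 0 < 2 / e by rewrite divr_gt0.
have tailB : 1 - std_normal_cdf (2 / e) <= e / 2.
  by rewrite -std_normal_cdfN (le_trans (std_normal_tail_le_inv B0))// invf_div.
near=> n.
have bB : 2 / e <= b n by near: n; move/cvgryPge : b_oo; exact.
have cdf_le1 := std_normal_cdf_le1 (b n).
have cdf_mono := le_std_normal_cdf bB.
apply/andP; split.
  (* Since [b n >= 2 / e], the target [1 - Phi (b n)] is below [e], so nonnegativity of the risk
     suffices. *)
  apply: (@le_trans _ _ 0%E); first by rewrite lee_fin; lra.
  by near: n.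
(* Shrinking classes reduce the upper bound to the fixed level [2 / e], where the first half applies
   with slack [e / 2]. *)
apply: le_trans (sup_risk_antitone _ _ _ _ _ _ bB) _.
apply: (@le_trans _ _ (1 - std_normal_cdf (2 / e) + e / 2)%:E); last by rewrite lee_fin; lra.
by near: n; apply: ub; rewrite divr_gt0.
Unshelve. all: by end_near. Qed.
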